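(* Let $\frac32<\alpha<2$ and $C>0$ be constants and $\rho(m)=\frac{C}{m^\alpha}$. For a random group $\Gamma=\langle S\mid R\rangle\in\mathcal{M}^+(m,\rho)$, let $L$ be the link graph of $\Gamma$ defined below. Then, as $m\to\infty$, the probability that $L$ is connected and the second largest eigenvalue of the random walk on $L$ is less than $\frac{10}{\sqrt C\,m^{1-\frac\alpha2}}$ tends to $1$.
   Context: Positive triangular model $\mathcal{M}^+(m,\rho)$: $\Gamma=\langle S\mid R\rangle$ with $S=\{s_1,\dots,s_m\}$, where $R$ is a random subset of the $m^3$ positive words $s_is_js_k$ ($1\le i,j,k\le m$), each chosen independently with probability $\rho(m)$. The link graph $L$ (the link of a vertex in the Cayley complex of $\Gamma$) is the bipartite multigraph with vertex set $S\sqcup S^{-1}$ in which each relator $s_is_js_k\in R$ contributes the three edges $\{s_j,s_i^{-1}\}$, $\{s_k,s_j^{-1}\}$, $\{s_i,s_k^{-1}\}$, counted with multiplicity. The random walk on a (multi)graph is the operator $(A\phi)(v)=\frac{1}{m(v)}\sum_{u}(\text{number of edges }\{u,v\})\,\phi(u)$, where $m(v)$ is the degree of $v$ counted with multiplicity; it is self-adjoint on $\ell^2$ with weights $m(v)$ and its eigenvalues lie in $[-1,1]$, the largest being $1$. *)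

(* Defs.v *)
From HB Require Import structures.
From mathcomp Require Import all_boot all_order all_algebra.
From mathcomp Require Import all_classical all_reals all_analysis.
From mathcomp Require Import polyrcf.
Set Implicit Arguments. Unset Strict Implicit. Unset Printing Implicit Defensive.
Import Order.TTheory GRing.Theory Num.Theory.
Local Open Scope ring_scope.

(* Positive words s_i s_j s_k, encoded as ((i, j), k). *)
Definition word (m : nat) : finType := ('I_m * 'I_m * 'I_m)%type.

(* Vertices of the link: inl i = s_i, inr i = s_i^{-1}. *)
Definition lvert (m : nat) : finType := ('I_m + 'I_m)%type.

(* The three (undirected) edges contributed by the relator s_i s_j s_k:
   {s_j, s_i^-1}, {s_k, s_j^-1}, {s_i, s_k^-1}. *)
Definition relator_edges (m : nat) (r : word m) : seq (lvert m * lvert m) :=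
  let: (i, j, k) := r in
  [:: (inl j, inr i); (inl k, inr j); (inl i, inr k)].

Definition link_mult (m : nat) (Rel : {set word m}) (u v : lvert m) : nat :=
  \sum_(r in Rel)
     count (fun e => (e == (u, v)) || (e == (v, u))) (relator_edges r).

Definition link_deg (m : nat) (Rel : {set word m}) (v : lvert m) : nat :=
  \sum_(u : lvert m) link_mult Rel u v.

Definition link_connected (m : nat) (Rel : {set word m}) : bool :=
  [forall u : lvert m, forall v : lvert m,
     connect (fun x y => 0 < link_mult Rel x y)%N u v].

Definition rw_matrix (R : realType) (m : nat) (Rel : {set word m})
  : 'M[R]_(#|lvert m|) :=
  \matrix_(a, b)
     ((link_mult Rel (enum_val b) (enum_val a))%:R
        / (link_deg Rel (enum_val a))%:R).

(* Real eigenvalues counted with algebraic multiplicity, in non-increasing order.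
   (The operator is self-adjoint, so all its eigenvalues are real.) *)
Definition eigs_desc (R : realType) (n : nat) (A : 'M[R]_n) : seq R :=
  let p := char_poly A in
  sort (fun x y : R => y <= x)
       (flatten [seq nseq (mup x p) x | x <- rootsR p]).

Definition second_eig (R : realType) (n : nat) (A : 'M[R]_n) : R :=
  nth 0 (eigs_desc A) 1.

(* Probability of an event in the positive triangular model M^+(m, p):
   each of the m^3 positive words is a relator independently with prob. p. *)
Definition prob_pos_tri (R : realType) (m : nat) (p : R)
  (E : pred {set word m}) : R :=
  \sum_(Rel : {set word m} | E Rel)
     p ^+ #|Rel| * (1 - p) ^+ (#|[set: word m]| - #|Rel|).

Arguments prob_pos_tri {R} m p E.

(* Main.v *)
(** Let [D = m^2 p] be the expected number of link edges of one type at a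
    vertex and [s = sqrt D].  The link is the union of three bipartite graphs,
    the [t]-th one formed by the [t]-th edges of the relators, so its adjacency
    matrix is the sum of three centered matrices [H_t], each with independent
    relators as edge weights, and of a multiple of the adjacency matrix of the
    complete bipartite graph, whose quadratic form vanishes on the vectors with
    zero sum over [S].

    The norm of [H_t] is bounded by the moment method: the expectation of
    [tr H_t^N] is a sum over walks of length [N] in which every relator is used
    at least twice.  Such a walk is built step by step; while it looks like a
    depth-first tour of a tree, a step either opens a new relator (weight [D]) or
    closes the unique open one at the current vertex, and every departure from
    this pattern costs a factor [1 / s] or [1 / m], against only polynomially in
    [N] many more choices.  With [N] of order [log m] this gives
    [norm H_t <= 6 s] with high probability, while all degrees are at least
    [2 D] by Chernoff's bound.

    A second eigenvalue above [9 / s], or a second component, would give a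
    two-dimensional space of vectors [f] with [<f, A f> > (9 / s) <f, deg f>]; it
    contains a non-zero vector with zero sum over [S], for which
    [<f, A f> <= 18 s |f|^2 <= (9 / s) <f, deg f>]. *)
Require Import Defs.
From HB Require Import structures.
From mathcomp Require Import all_boot all_order all_algebra.
From mathcomp Require Import all_classical all_reals all_analysis.
From mathcomp Require Import polyrcf ring lra zify.
Set Implicit Arguments. Unset Strict Implicit. Unset Printing Implicit Defensive.
Import Order.TTheory GRing.Theory Num.Theory numFieldNormedType.Exports.
Local Open Scope ring_scope.

(** * Random subsets *)

Section BernoulliSubset.
Variables (R : realType) (T : finType) (p : R).
Implicit Types (f g : {set T} -> R) (S : {set T}).

Definition subset_weight S : R :=
  p ^+ #|S| * (1 - p) ^+ (#|[set: T]| - #|S|).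

Definition expect f : R := \sum_(S : {set T}) subset_weight S * f S.

Lemma subset_weightE S :
  subset_weight S = \prod_(t : T) (if t \in S then p else 1 - p).
Proof.
rewrite /subset_weight (bigID (fun t => t \in S)) /=; congr (_ * _).
  rewrite (eq_bigr (fun=> p)) => [|t ->//].
  by rewrite big_const iter_mulr_1.
rewrite (eq_bigr (fun=> 1 - p)) => [|t /negbTE->//].
rewrite big_const iter_mulr_1; congr (_ ^+ _).
rewrite cardsT -(cardsC S) addKn.
by apply: eq_card => t; rewrite !inE.
Qed.

(** Independence of the memberships: expanding the product over [t] yields one term for each subset,
    with exactly its weight. *)
Lemma expect_prod (g : T -> bool -> R) :
  expect (fun S => \prod_t g t (t \in S))
  = \prod_t (p * g t true + (1 - p) * g t false).
Proof.
rewrite bigA_distr; apply: eq_bigr => S _.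
rewrite subset_weightE -big_split; apply: eq_bigr => t _ /=.
by case: (t \in S).
Qed.

Lemma expect_sum (I : Type) (r : seq I) (P : pred I) (F : I -> {set T} -> R) :
  expect (fun S => \sum_(i <- r | P i) F i S) = \sum_(i <- r | P i) expect (F i).
Proof.
rewrite /expect exchange_big; apply: eq_bigr => S _.
by rewrite mulr_sumr.
Qed.

Lemma expectZ c f : expect (fun S => c * f S) = c * expect f.
Proof.
by rewrite /expect mulr_sumr; apply: eq_bigr => S _; rewrite mulrCA.
Qed.

Lemma expectD f g : expect (fun S => f S + g S) = expect f + expect g.
Proof.
by rewrite /expect -big_split; apply: eq_bigr => S _; rewrite mulrDr.
Qed.

Lemma expect1 : expect (fun=> 1) = 1.
Proof.
transitivity (expect (fun S => \prod_(t : T) 1)).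
  by apply: eq_bigr => S _; rewrite big1.
by rewrite (expect_prod (fun _ _ => 1)) big1 // => t _; ring.
Qed.

Hypothesis p01 : 0 <= p <= 1.

Lemma subset_weight_ge0 S : 0 <= subset_weight S.
Proof.
by case/andP: p01 => p0 p1; rewrite mulr_ge0 ?exprn_ge0 // subr_ge0.
Qed.

Lemma ler_expect f g : (forall S, f S <= g S) -> expect f <= expect g.
Proof.
move=> fg; apply: ler_sum => S _.
by rewrite ler_wpM2l ?subset_weight_ge0.
Qed.

Lemma expect_cprod_bernoulli (h : seq T) :
  expect (fun S => \prod_(t <- h) ((t \in S)%:R - p))
  = \prod_t (p * (1 - p) ^+ count_mem t h + (1 - p) * (- p) ^+ count_mem t h).
Proof.
pose g t (b : bool) : R := (b%:R - p) ^+ count_mem t h.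
transitivity (expect (fun S => \prod_t g t (t \in S))).
  apply: eq_bigr => S _; congr (_ * _).
  elim: h @g => [|u h IH] /=; first by rewrite big_nil big1.
  rewrite big_cons IH (bigD1 u) //= [in RHS](bigD1 u) //= eqxx add1n exprS mulrA.
  by congr (_ * _); apply: eq_bigr => t tu; rewrite eq_sym (negbTE tu).
rewrite expect_prod; apply: eq_bigr => t _.
by rewrite /g !mulr1n mulr0n sub0r.
Qed.

(** Raising the exponent beyond 2 only shrinks the powers of [1 - p] and [p], so the variance
    [p * (1 - p)] dominates. *)
Lemma bernoulli_cmoment_norm (c : nat) :
  `|p * (1 - p) ^+ c.+2 + (1 - p) * (- p) ^+ c.+2| <= p.
Proof.
case/andP: p01 => p0 p1.
have q0 : 0 <= 1 - p by rewrite subr_ge0.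
have q1 : 1 - p <= 1 by lra.
have A : (1 - p) ^+ c.+2 <= (1 - p) ^+ 2.
  by rewrite -addn2 exprD ler_piMl ?exprn_ge0 ?exprn_ile1.
have B : p ^+ c.+2 <= p ^+ 2 by rewrite -addn2 exprD ler_piMl ?exprn_ge0 ?exprn_ile1.
move: (c.+2) A B => n A B.
rewrite (le_trans (ler_normD _ _)) // !normrM !normrX normrN !ger0_norm //.
rewrite (@le_trans _ _ (p * (1 - p) ^+ 2 + (1 - p) * p ^+ 2)) //.
  by rewrite lerD ?ler_wpM2l.
have : 0 <= p * p by rewrite mulr_ge0.
by rewrite !expr2; lra.
Qed.

End BernoulliSubset.

(** * Walks on a multigraph and their open edges *)

Section EdgeHistory.
Variables (V T : finType) (a b : T -> V).
Hypothesis a_neq_b : forall t, a t != b t.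
Implicit Types (u v w y : V) (t : T) (h : seq T).

Definition incident v t := (v == a t) || (v == b t).
Definition other_end v t := if v == a t then b t else a t.

Lemma other_end_neq u t : incident u t -> u != other_end u t.
Proof.
by rewrite /incident /other_end; have [->|ua _] := eqVneq u (a t).
Qed.

Lemma incidentE u t v :
  incident u t -> incident v t = (v == u) || (v == other_end u t).
Proof.
rewrite /incident /other_end; have [->//|ua /= /eqP ->] := eqVneq u (a t).
by rewrite orbC.
Qed.

(** An edge used exactly once is open: by centering, a walk that ends with an open edge has
    expectation zero. *)
Definition once h t := count_mem t h == 1%N.
Definition open_edges h := [set t | once h t].
Definition open_at h v := #|[set t | once h t && incident v t]|.
Definition support h := [set t in h].

(* Along a tree-like walk from [r] to [u], at most two open edges meet at
   each vertex, and at most one meets at the current vertex [u]; the excess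
   measures the deviation from this pattern. *)
Definition excess h u : nat := (\sum_v (open_at h v + (v == u) - 2))%N.

Lemma card_open_edges h : (#|open_edges h| <= size h)%N.
Proof.
apply: leq_trans (card_size h); apply/subset_leq_card/fintype.subsetP => t.
by rewrite inE /once -has_pred1 has_count => /eqP->.
Qed.

Lemma card_open_vertices h : (#|[set v | 0 < open_at h v]| <= (size h).*2)%N.
Proof.
apply: (@leq_trans (\sum_v open_at h v)%N).
  rewrite -sum1_card big_mkcond /=; apply: leq_sum => v _; rewrite inE.
  by case: ltnP.
apply: (@leq_trans (\sum_(t in open_edges h) 2)%N); last first.
  by rewrite sum_nat_const muln2 leq_double card_open_edges.
under eq_bigr do rewrite /open_at -sum1_card.
rewrite (exchange_big_dep (mem (open_edges h))) /= => [|v t _]; last first.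
  by rewrite !inE => /andP[].
apply: leq_sum => t; rewrite inE => ot.
have <- : #|[set a t; b t]| = 2%N by rewrite cards2 a_neq_b.
rewrite sum1_card.
apply/subset_leq_card/fintype.subsetP => v.
change (t \in [set t0 | once h t0 && incident v t0] -> v \in [set a t; b t]).
by rewrite !inE ot.
Qed.

(** * Effect of one step of the walk on the open edges and the excess *)

Section Update.
Variables (u : V) (t : T) (h : seq T).
Hypothesis ut : incident u t.
Let y := other_end u t.

Lemma excess_pair h' w : excess h' w =
  ((open_at h' u + (u == w) - 2) + ((open_at h' y + (y == w) - 2)
   + \sum_(v | (v != u) && (v != y)) (open_at h' v + (v == w) - 2)))%N.
Proof.
rewrite /excess (bigD1 u) //= (bigD1 y) //=.
by rewrite eq_sym other_end_neq.
Qed.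

Lemma excess_rest h' w : (w == u) || (w == y) ->
  (\sum_(v | (v != u) && (v != y)) (open_at h' v + (v == w) - 2)
   = \sum_(v | (v != u) && (v != y)) (open_at h' v - 2))%N.
Proof.
move=> wuy; apply: eq_bigr => v /andP[vu vy].
suff /negbTE -> : v != w by rewrite addn0.
by case/orP: wuy => /eqP->.
Qed.

Lemma once_cons t' : once (t :: h) t' =
  if t' == t then t \notin h else once h t'.
Proof.
rewrite /once /= eq_sym; have [->|_] := eqVneq t' t; last by [].
by rewrite add1n eqSS -has_pred1 has_count -eqn0Ngt.
Qed.

Lemma once_mem t' : once h t' -> t' \in h.
Proof. by rewrite -has_pred1 has_count /once => /eqP->. Qed.

Lemma support_cons_new : t \notin h -> #|support (t :: h)| = #|support h|.+1.
Proof.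
move=> th; have -> : support (t :: h) = (t |: support h)%SET.
  by apply/setP => t'; rewrite !inE.
by rewrite cardsU1 inE th.
Qed.

Lemma support_cons_old : t \in h -> #|support (t :: h)| = #|support h|.
Proof.
move=> th; apply: eq_card => t'; rewrite !inE.
by have [->|] := eqVneq t' t.
Qed.

Lemma open_edges_new :
  t \notin h -> #|open_edges (t :: h)| = #|open_edges h|.+1.
Proof.
move=> th; have -> : open_edges (t :: h) = (t |: open_edges h)%SET.
  by apply/setP => t'; rewrite !inE once_cons th; case: eqP.
by rewrite cardsU1 inE (contra (@once_mem t)).
Qed.

Lemma open_edges_once :
  once h t -> #|open_edges h| = #|open_edges (t :: h)|.+1.
Proof.
move=> th; rewrite (cardsD1 t) inE th add1n; congr _.+1.
apply: eq_card => t'; rewrite !inE once_cons once_mem //.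
by case: eqP.
Qed.

Lemma open_edges_old : t \in h -> ~~ once h t ->
  #|open_edges (t :: h)| = #|open_edges h|.
Proof.
move=> th oth; apply: eq_card => t'; rewrite !inE once_cons th.
by case: eqP => // ->; rewrite (negbTE oth).
Qed.

Lemma open_at_new v :
  t \notin h -> open_at (t :: h) v = (open_at h v + incident v t)%N.
Proof.
move=> th; rewrite /open_at; have [vt|vt] := boolP (incident v t).
  rewrite (cardsD1 t) inE once_cons eqxx th vt /= addnC; congr (_ + _)%N.
  apply: eq_card => t'; rewrite !inE once_cons.
  case: eqP => //= ->; rewrite vt andbT.
  by apply/esym/negbTE; apply: contra th; apply: once_mem.
rewrite addn0; apply: eq_card => t'; rewrite !inE once_cons.
by case: eqP => //= ->; rewrite (negbTE vt) !andbF.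
Qed.

Lemma open_at_once v :
  once h t -> open_at h v = (open_at (t :: h) v + incident v t)%N.
Proof.
move=> th; rewrite /open_at; have [vt|vt] := boolP (incident v t).
  rewrite (cardsD1 t) inE th vt /= addnC; congr (_ + _)%N.
  apply: eq_card => t'; rewrite !inE once_cons once_mem //.
  by case: eqP.
rewrite addn0; apply: eq_card => t'; rewrite !inE once_cons.
by case: eqP => //= ->; rewrite (negbTE vt) !andbF.
Qed.

Lemma open_at_old v : t \in h -> ~~ once h t ->
  open_at (t :: h) v = open_at h v.
Proof.
move=> th oth; apply: eq_card => t'; rewrite !inE once_cons th.
by case: eqP => // ->; rewrite (negbTE oth).
Qed.

Let uy : u != y. Proof. exact: other_end_neq. Qed.

Let inc_rest v : (v != u) && (v != y) -> incident v t = false.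
Proof. by case/andP=> vu vy; rewrite (incidentE v ut) (negbTE vu) (negbTE vy). Qed.

Let incu : incident u t = true. Proof. exact: ut. Qed.
Let incy : incident y t = true.
Proof. by rewrite (incidentE y ut) eqxx orbT. Qed.

(** At [u] the new open edge replaces the marker of the current position. At [y] both edge and
    marker arrive; this stays within the allowance of two if no open edge met [y], and adds at most
    two otherwise. *)
Lemma excess_new : t \notin h ->
  (excess (t :: h) y <= excess h u + (0 < open_at h y)%N.*2)%N.
Proof.
move=> th; rewrite !excess_pair !excess_rest ?eqxx ?orbT //.
rewrite (eq_bigr (fun v => open_at h v - 2)%N) => [|v vr]; last first.
  by rewrite open_at_new // inc_rest // addn0.
rewrite !open_at_new // incu incy (negbTE uy) (eq_sym y u) (negbTE uy).
lia.
Qed.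

(** At [y] the marker replaces the closed edge. At [u] both disappear, which lowers the excess as
    soon as a second open edge met [u]; this gain pays for the choice among the open edges at
    [u]. *)
Lemma excess_once : once h t ->
  (excess (t :: h) y + (1 < open_at h u) <= excess h u)%N.
Proof.
move=> th; rewrite !excess_pair !excess_rest ?eqxx ?orbT //.
rewrite [in leqRHS](eq_bigr (fun v => open_at (t :: h) v - 2)%N) => [|v vr].
  rewrite !(open_at_once _ th) incu incy (negbTE uy) (eq_sym y u) (negbTE uy).
  lia.
by rewrite (open_at_once _ th) inc_rest // addn0.
Qed.

(** The open edges stay the same; only the marker moves, at a cost of at most one at [y]. *)
Lemma excess_old : t \in h -> ~~ once h t ->
  (excess (t :: h) y <= (excess h u).+1)%N.
Proof.
move=> th oth; rewrite !excess_pair !excess_rest ?eqxx ?orbT //.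
rewrite (eq_bigr (fun v => open_at h v - 2)%N) => [|v vr]; last first.
  by rewrite open_at_old.
rewrite !open_at_old // (negbTE uy) (eq_sym y u) (negbTE uy).
lia.
Qed.

End Update.
End EdgeHistory.

(** * Moments of the centered adjacency matrix *)

Section WalkMoments.
Variables (R : realType) (V T : finType) (a b : T -> V).
Hypothesis a_neq_b : forall t, a t != b t.
Implicit Types (u v y : V) (t : T) (h : seq T) (x : T -> R).

(* The [(u, v)] entry of the [n]-th power of the adjacency matrix of the
   multigraph whose edge [t], joining [a t] and [b t], has weight [x t]. *)
Fixpoint walk_sum x n u v : R :=
  if n is n'.+1 then
    \sum_(t | incident a b u t) x t * walk_sum x n' (other_end a b u t) v
  else (u == v)%:R.

Definition centered (p : R) (S : {set T}) t : R := (t \in S)%:R - p.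

(** The list [h] records the steps already made and [n] steps remain; each step moves one factor
    from the walk sum into the history. *)
Definition walk_moment p n h u v : R :=
  expect p (fun S => (\prod_(t <- h) centered p S t)
                     * walk_sum (centered p S) n u v).

Lemma walk_momentS p n h u v : walk_moment p n.+1 h u v =
  \sum_(t | incident a b u t) walk_moment p n (t :: h) (other_end a b u t) v.
Proof.
rewrite -expect_sum; apply: eq_bigr => S _; congr (_ * _).
rewrite /= mulr_sumr; apply: eq_bigr => t _.
by rewrite big_cons mulrCA mulrA.
Qed.

Variables (p s : R) (Delta mu N : nat).
Hypothesis p01 : 0 <= p <= 1.
Hypothesis s_gt0 : 0 < s.
Hypothesis N_gt0 : (0 < N)%N.
Hypothesis degree_le :
  forall u, (#|[set t | incident a b u t]| <= Delta)%N.
Hypothesis multiplicity_le : forall u v,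
  (#|[set t | incident a b u t && (other_end a b u t == v)]| <= mu)%N.
Hypothesis degree_p : Delta%:R * p = s ^+ 2.
Hypothesis multiplicity_p :
  2 * N%:R ^+ 3 * (mu%:R * p) + N%:R ^+ 2 * s <= s ^+ 2.

(** A potential for which each step costs at most [3 * s] in total. An open edge carries [1 / s],
    given back when it closes, so that opening (total weight [Delta * p / s = s]) and closing
    account for [s] each; a unit of excess stands for up to [N] later choices. *)
Definition walk_moment_bound n h u : R :=
  3 ^+ n * s ^+ n * p ^+ #|support h| * s ^- #|open_edges h|
  * N%:R ^+ excess a b h u.

(** An edge used once contributes a factor zero, any other edge of the history at most [p]. *)
Lemma expect_cprod_le h :
  `|expect p (fun S => \prod_(t <- h) centered p S t)|
  <= p ^+ #|support h| * (#|open_edges h| == 0)%N%:R.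
Proof.
rewrite expect_cprod_bernoulli normr_prod.
case: eqP => [/eqP|/eqP]; rewrite cards_eq0 => /eqP o0; last first.
  have [t] : exists t, t \in open_edges h by apply/set0Pn/eqP.
  rewrite inE /once => /eqP ct; rewrite mulr0 (bigD1 t) //= ct.
  have -> : p * (1 - p) ^+ 1 + (1 - p) * (- p) ^+ 1 = 0 by ring.
  by rewrite normr0 mul0r.
rewrite mulr1 -prodr_const [leRHS]big_mkcond /=.
apply: ler_prod => t _; rewrite normr_ge0 inE /=.
have : t \notin open_edges h by rewrite o0 inE.
rewrite inE /once -has_pred1 has_count.
case: (count_mem t h) => [_|[//|c] _] /=.
  have -> : p * (1 - p) ^+ 0 + (1 - p) * (- p) ^+ 0 = 1 by ring.
  by rewrite normr1.
exact: bernoulli_cmoment_norm.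
Qed.

Lemma natN_ge1 : 1 <= N%:R :> R. Proof. by rewrite ler1n. Qed.

Lemma walk_moment0_le h u v :
  `|walk_moment p 0 h u v| <= walk_moment_bound 0 h u.
Proof.
have -> : walk_moment p 0 h u v =
    (u == v)%:R * expect p (fun S => \prod_(t <- h) centered p S t).
  by rewrite -expectZ; apply: eq_bigr => S _; rewrite /= (mulrC (u == v)%:R).
case/andP: p01 => p0 _.
apply: (@le_trans _ _ (p ^+ #|support h| * (#|open_edges h| == 0)%N%:R)).
  rewrite normrM normr_nat (le_trans _ (expect_cprod_le h)) //.
  by rewrite ler_piMl // ; case: eqP.
rewrite /walk_moment_bound !expr0 !mul1r -mulrA ler_wpM2l ?exprn_ge0 //.
have [->|_] := eqVneq #|open_edges h| 0%N.
  by rewrite expr0 invr1 mul1r exprn_ege1 // natN_ge1.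
by rewrite mulr_ge0 ?invr_ge0 ?exprn_ge0 ?ltW // ltr0n.
Qed.

(** The four terms: a new edge; the surcharge when it leads to a vertex meeting an open edge, where
    the excess may grow by two; a closing, shared among the open edges at [u]; the reuse of an edge
    of the history. *)
Definition step_factor h u t : R :=
  (t \notin h)%:R * (p / s)
  + ((t \notin h) && (0 < open_at a b h (other_end a b u t))%N)%:R
    * (N%:R ^+ 2 * (p / s))
  + (once h t)%:R * (s / (open_at a b h u)%:R)
  + (t \in h)%:R * N%:R.

Lemma step_bound n h u t : incident a b u t -> (size h <= N)%N ->
  walk_moment_bound n (t :: h) (other_end a b u t)
  <= walk_moment_bound n h u * step_factor h u t.
Proof.
move=> ut hN; case/andP: p01 => p0 _; have N1 := natN_ge1.
have N0 : 0 <= N%:R :> R by rewrite ler0n.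
have s0 : s != 0 by rewrite gt_eqF.
rewrite /walk_moment_bound /step_factor.
set c := 3 ^+ n * s ^+ n.
have c0 : 0 <= c by rewrite mulr_ge0 ?exprn_ge0 ?ltW.
set y := other_end a b u t.
have si0 k : 0 <= s ^- k by rewrite invr_ge0 exprn_ge0 // ltW.
have [th|th] := boolP (t \in h); last first.
  rewrite (contraNF (@once_mem _ h t) th) /= !mul0r !addr0 mul1r.
  rewrite support_cons_new // open_edges_new //.
  have := excess_new a_neq_b ut th; rewrite -/y => ex.
  set P := p ^+ #|support h|; set Q := s ^- #|open_edges h|.
  have -> : s ^- #|open_edges h|.+1 = Q / s by rewrite exprSr invfM.
  have P0 : 0 <= P by rewrite exprn_ge0.
  rewrite exprSr -/P.
  have -> : c * (P * p) * (Q / s) * N%:R ^+ excess a b (t :: h) y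
     = c * P * Q * (p / s) * N%:R ^+ excess a b (t :: h) y by ring.
  have -> : c * P * Q * N%:R ^+ excess a b h u *
      (p / s + (0 < open_at a b h y)%:R * (N%:R ^+ 2 * (p / s)))
     = c * P * Q * (p / s) * (N%:R ^+ excess a b h u
          * (1 + (0 < open_at a b h y)%:R * N%:R ^+ 2)) by ring.
  have ps0 : 0 <= p / s by rewrite divr_ge0 // ltW.
  have Q0 : 0 <= Q by exact: si0.
  apply: ler_wpM2l; first by rewrite (mulr_ge0 _ ps0) // (mulr_ge0 _ Q0) // mulr_ge0.
  apply: le_trans (ler_weXn2l N1 ex) _.
  rewrite exprD ler_wpM2l ?exprn_ge0 //.
  by case: (0 < _)%N; rewrite /= ?mul1r ?mul0r ?addr0 ?expr0 // lerDr ler01.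
rewrite /= !mul0r !add0r mul1r support_cons_old //.
have [oth|oth] := boolP (once h t).
  have ou : (0 < open_at a b h u)%N.
    by rewrite /open_at card_gt0; apply/set0Pn; exists t; rewrite inE oth ut.
  have oN : (open_at a b h u <= N)%N.
    apply: leq_trans hN; apply: leq_trans (card_open_edges h).
    by apply/subset_leq_card/fintype.subsetP => t'; rewrite !inE => /andP[].
  have := excess_once a_neq_b ut oth; rewrite -/y => ex.
  rewrite (open_edges_once oth) mul1r.
  set Q := s ^- #|open_edges (t :: h)|.
  have -> : s ^- #|open_edges (t :: h)|.+1 = Q / s by rewrite exprSr invfM.
  set P := p ^+ #|support h|.
  have P0 : 0 <= P by rewrite exprn_ge0.
  set e := excess a b h u; set o := open_at a b h u.
  have o0 : o%:R != 0 :> R by rewrite pnatr_eq0 -lt0n.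
  have -> : c * P * (Q / s) * N%:R ^+ e * (s / o%:R + N%:R)
     = c * P * Q * (N%:R ^+ e * (o%:R^-1 + N%:R / s)) by field; rewrite s0.
  have Q0 : 0 <= Q by exact: si0.
  apply: ler_wpM2l; first by rewrite (mulr_ge0 _ Q0) // mulr_ge0.
  (* The division by [o] is affordable: if [o] exceeds 1, the drop of the excess gains a factor [N],
     and [o <= N]. *)
  apply: (@le_trans _ _ (N%:R ^+ e / o%:R)); last first.
    by rewrite ler_wpM2l ?exprn_ge0 // lerDl divr_ge0 // ltW.
  rewrite ler_pdivlMr ?ltr0n //.
  apply: le_trans (ler_weXn2l N1 ex); rewrite exprD ler_wpM2l ?exprn_ge0 //.
  rewrite -/o; have [k1|k1] := ltnP 1 o; first by rewrite expr1 ler_nat.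
  by rewrite expr0 (ler_nat _ _ 1).
have := excess_old a_neq_b ut th oth; rewrite -/y => ex.
rewrite open_edges_old // mul0r add0r -[leRHS]mulrA -exprSr.
set Q := s ^- _; set P := p ^+ #|support h|.
have P0 : 0 <= P by rewrite exprn_ge0.
have Q0 : 0 <= Q by exact: si0.
apply: ler_wpM2l; first by rewrite (mulr_ge0 _ Q0) // mulr_ge0.
exact: ler_weXn2l.
Qed.

(** New edges contribute at most [s] by [degree_p]. Closings contribute at most [s] because exactly
    [open_at a b h u] edges can be closed. The other two terms fit together into a third [s] by
    [multiplicity_p]. *)
Lemma sum_step_factor h u : (size h <= N)%N ->
  \sum_(t | incident a b u t) step_factor h u t <= 3 * s.
Proof.
move=> hN; case/andP: p01 => p0 _.
have ps0 : 0 <= p / s by rewrite divr_ge0 // ltW.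
have sumB (Q : pred T) (c : R) :
    \sum_(t | incident a b u t) (Q t)%:R * c
    = #|[set t | incident a b u t && Q t]|%:R * c.
  rewrite -mulr_suml; congr (_ * _); rewrite -sum1_card natr_sum.
  rewrite (bigID Q) /= [X in _ + X]big1 ?addr0 => [|t /andP[_ /negbTE->]//].
  apply: eq_big => [t|t /andP[_ ->]//]; by rewrite inE.
rewrite /step_factor !big_split /= !sumB.
have N0 : 0 <= N%:R :> R by rewrite ler0n.
have new_le : #|[set t | incident a b u t && (t \notin h)]|%:R * (p / s) <= s.
  apply: (@le_trans _ _ (Delta%:R * (p / s))).
    rewrite ler_wpM2r // ler_nat; apply: leq_trans (degree_le u).
    by apply/subset_leq_card/fintype.subsetP => t; rewrite !inE => /andP[].
  by rewrite mulrA degree_p expr2 mulfK // gt_eqF.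
have once_le : #|[set t | incident a b u t && once h t]|%:R
    * (s / (open_at a b h u)%:R) <= s.
  have -> : #|[set t | incident a b u t && once h t]| = open_at a b h u.
    by apply: eq_card => t; rewrite !inE andbC.
  have [->|o0] := eqVneq (open_at a b h u) 0%N; first by rewrite mul0r ltW.
  by rewrite mulrCA divff ?mulr1 // pnatr_eq0.
have old_le : #|[set t | incident a b u t && (t \in h)]|%:R * N%:R
    <= N%:R ^+ 2 :> R.
  rewrite expr2 ler_wpM2r // ler_nat; apply: leq_trans hN.
  apply: leq_trans (card_size h).
  by apply/subset_leq_card/fintype.subsetP => t; rewrite !inE => /andP[].
(* At most [2 * N] vertices meet an open edge, and at most [mu] edges join [u] to each of them. *)
have back_le : (#|[set t | incident a b u t
    && ((t \notin h) && (0 < open_at a b h (other_end a b u t))%N)]|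
    <= N.*2 * mu)%N.
  apply: (@leq_trans (\sum_(v in [set v | 0 < open_at a b h v]) mu)%N).
    apply: (@leq_trans (\sum_(v in [set v | 0 < open_at a b h v])
        #|[set t | incident a b u t && (other_end a b u t == v)]|)%N).
      rewrite -sum1_card (partition_big (other_end a b u)
        (mem [set v | 0 < open_at a b h v]%N)) /=; last first.
        by move=> t; rewrite !inE => /and3P[].
      apply: leq_sum => v _; rewrite sum1_card.
      apply/subset_leq_card/fintype.subsetP => t.
      by rewrite unfold_in /= !inE => /andP[/andP[-> _] ->].
    by apply: leq_sum => v _; apply: multiplicity_le.
  rewrite sum_nat_const leq_mul2r; apply/orP; right.
  by rewrite (leq_trans (card_open_vertices a_neq_b h)) // leq_double.
have back_le' : #|[set t | incident a b u t
    && ((t \notin h) && (0 < open_at a b h (other_end a b u t))%N)]|%:R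
    * (N%:R ^+ 2 * (p / s)) + N%:R ^+ 2 <= s.
  apply: (@le_trans _ _ ((2 * N%:R ^+ 3 * (mu%:R * p) + N%:R ^+ 2 * s) / s)).
    rewrite mulrDl mulfK ?gt_eqF // lerD2r.
    have -> : 2 * N%:R ^+ 3 * (mu%:R * p) / s
       = (N.*2 * mu)%N%:R * (N%:R ^+ 2 * (p / s)) :> R.
      by rewrite natrM -muln2 natrM; ring.
    apply: ler_wpM2r; last by rewrite ler_nat.
    by rewrite (mulr_ge0 _ ps0) ?exprn_ge0.
  by rewrite ler_pdivrMr // -expr2.
lra.
Qed.

Lemma walk_moment_le n h u v : (size h + n <= N)%N ->
  `|walk_moment p n h u v| <= walk_moment_bound n h u.
Proof.
elim: n h u => [|n IH] h u hnN; first exact: walk_moment0_le.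
rewrite walk_momentS (le_trans (ler_norm_sum _ _ _)) //.
have hN : (size h <= N)%N by lia.
apply: (@le_trans _ _ (\sum_(t | incident a b u t)
    walk_moment_bound n h u * step_factor h u t)).
  apply: ler_sum => t ut; apply: le_trans (step_bound n ut hN).
  by apply: IH; rewrite /= addSnnS.
have b0 : 0 <= walk_moment_bound n h u.
  case/andP: p01 => p0 _.
  by rewrite !mulr_ge0 ?invr_ge0 ?exprn_ge0 // ltW.
rewrite -mulr_sumr (le_trans (ler_wpM2l b0 (sum_step_factor u hN))) //.
by rewrite /walk_moment_bound !exprS; lra.
Qed.

Lemma expect_walk_sum_le u v :
  expect p (fun S => walk_sum (centered p S) N u v) <= 3 ^+ N * s ^+ N.
Proof.
have -> : expect p (fun S => walk_sum (centered p S) N u v)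
    = walk_moment p N [::] u v.
  by apply: eq_bigr => S _; rewrite big_nil mul1r.
have /(_ [::] u v) := walk_moment_le (n := N); rewrite add0n => /(_ (leqnn _)).
move=> /(le_trans (ler_norm _)) /le_trans; apply.
rewrite /walk_moment_bound.
have -> : support [::] = finset.set0 :> {set T} by apply/setP => t; rewrite !inE.
have -> : open_edges [::] = finset.set0 :> {set T} by apply/setP => t; rewrite !inE.
rewrite cards0 !expr0 invr1 !mulr1 /excess big1 ?expr0 ?mulr1 // => w _.
rewrite /open_at (_ : [set t | _] = finset.set0) ?cards0; last first.
  by apply/setP => t; rewrite !inE.
by case: (_ == _).
Qed.

End WalkMoments.

(** * Quadratic forms and the second eigenvalue *)

Section QuadraticForm.
Variable R : realType.

Lemma cauchy_schwarz_sum (I : finType) (f g : I -> R) :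
  (\sum_i f i * g i) ^+ 2 <= (\sum_i f i ^+ 2) * (\sum_i g i ^+ 2).
Proof.
(* Lagrange's identity *)
rewrite -subr_ge0 -(pmulr_rge0 _ (ltr0n R 2)).
suff -> : 2 * ((\sum_i f i ^+ 2) * (\sum_i g i ^+ 2) - (\sum_i f i * g i) ^+ 2)
   = \sum_i \sum_j (f i * g j - f j * g i) ^+ 2.
  by apply: sumr_ge0 => i _; apply: sumr_ge0 => j _; apply: sqr_ge0.
have mul_sums (u v : I -> R) :
    (\sum_i u i) * (\sum_i v i) = \sum_i \sum_j u i * v j.
  by rewrite mulr_suml; apply: eq_bigr => i _; rewrite mulr_sumr.
transitivity (\sum_i \sum_j f i ^+ 2 * g j ^+ 2
    + \sum_i \sum_j g i ^+ 2 * f j ^+ 2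
    + (-2) * \sum_i \sum_j f i * g i * (f j * g j)).
  by rewrite -!mul_sums; ring.
rewrite mulr_sumr -!big_split; apply: eq_bigr => i _ /=.
rewrite mulr_sumr -!big_split; apply: eq_bigr => j _ /=; ring.
Qed.

Variable n : nat.
Implicit Types (A : 'M[R]_n) (f g : 'rV[R]_n).

Definition qform A f : R := (f *m A *m f^T) 0 0.
Definition normsq f : R := \sum_i f 0 i ^+ 2.

Lemma normsq_ge0 f : 0 <= normsq f.
Proof. by apply: sumr_ge0 => i _; apply: sqr_ge0. Qed.

Lemma qformE A f : qform A f = \sum_i \sum_j f 0 i * A i j * f 0 j.
Proof.
rewrite /qform mxE exchange_big; apply: eq_bigr => j _ /=.
by rewrite !mxE mulr_suml.
Qed.

Lemma qform_sq A f : A^T = A -> qform (A ^+ 2) f = normsq (f *m A).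
Proof.
move=> symA; rewrite /qform expr2 -mulmxE mulmxA -mulmxA -{2}symA -trmx_mul.
by rewrite mxE; apply: eq_bigr => i _; rewrite !mxE expr2.
Qed.

Lemma qform_sqr_le A f : A^T = A ->
  qform A f ^+ 2 <= normsq f * qform (A ^+ 2) f.
Proof.
move=> symA; rewrite qform_sq // mulrC; apply: le_trans (cauchy_schwarz_sum _ _).
by rewrite /qform mxE; under eq_bigr do rewrite [_^T _ _]mxE.
Qed.

(** Cauchy-Schwarz in each column; for symmetric [A] the trace of [A ^+ 2] is the sum of the squared
    entries. *)
Lemma normsq_mulmx_le A f : A^T = A ->
  normsq (f *m A) <= normsq f * \tr (A ^+ 2).
Proof.
move=> symA; rewrite /mxtrace mulr_sumr; apply: ler_sum => j _.
rewrite mxE (le_trans (cauchy_schwarz_sum _ _)) // ler_wpM2l ?normsq_ge0 //.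
rewrite expr2 -mulmxE mxE ler_sum // => i _.
by rewrite -{2}symA mxE expr2.
Qed.

(** This replaces diagonalization: [qform_sqr_le] is iterated, squaring the matrix each time, which
    is why the exponent is a power of two. *)
Lemma qform_trace_le A f j : A^T = A ->
  qform A f ^+ (2 ^ j.+1) <= normsq f ^+ (2 ^ j.+1) * \tr (A ^+ (2 ^ j.+1)).
Proof.
elim: j A => [|j IH] A symA.
  rewrite (le_trans (qform_sqr_le f symA)) // expr2 -mulrA.
  by rewrite ler_wpM2l ?normsq_ge0 // qform_sq // normsq_mulmx_le.
have symA2 : (A ^+ 2)^T = A ^+ 2 by rewrite expr2 -mulmxE trmx_mul symA.
rewrite expnS !exprM.
apply: (@le_trans _ _ ((normsq f * qform (A ^+ 2) f) ^+ (2 ^ j.+1))).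
  rewrite lerXn2r ?nnegrE ?sqr_ge0 ?qform_sqr_le //.
  by rewrite mulr_ge0 ?normsq_ge0 // qform_sq ?normsq_ge0.
rewrite exprMn expr2 exprMn -mulrA ler_wpM2l ?exprn_ge0 ?normsq_ge0 //.
exact: IH.
Qed.

End QuadraticForm.

(** * Double roots of the characteristic polynomial *)

Section MultipleRoot.
Variable F : fieldType.

Lemma char_poly_conj n (B A : 'M[F]_n) : B \in unitmx ->
  char_poly (B *m A *m invmx B) = char_poly A.
Proof.
move=> uB; rewrite /char_poly /char_poly_mx.
set C := map_mx polyC B; set C' := map_mx polyC (invmx B).
have CC' : C *m C' = 1%:M by rewrite -map_mxM mulmxV // map_mx1.
have -> : 'X%:M - map_mx polyC (B *m A *m invmx B)
   = C *m ('X%:M - map_mx polyC A) *m C'.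
  rewrite !map_mxM -/C -/C' mulmxBr mulmxBl; congr (_ - _).
  by rewrite scalar_mxC -mulmxA CC' mulmx1.
by rewrite !det_mulmx mulrAC -det_mulmx CC' det1 mul1r.
Qed.

(* Completing an eigenvector to a basis makes the matrix block triangular; a
   double root of the characteristic polynomial is then still an eigenvalue of
   the remaining diagonal block. *)
Lemma double_root_char_poly n (A : 'M[F]_n) x :
  (1 < mup x (char_poly A))%N ->
  exists v w : 'rV[F]_n, exists c : F,
    [/\ v *m A = x *: v, w *m A = x *: w + c *: v
      & forall k l, k *: v + l *: w = 0 -> k = 0 /\ l = 0].
Proof.
move=> mx; have rx : root (char_poly A) x.
  by apply/negPn/negP => /mupNroot nr; rewrite nr in mx.
move: rx; rewrite -eigenvalue_root_char => /eigenvalueP[v0 v0A v0_neq0].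
case: n => [|n] in A mx v0 v0A v0_neq0 *.
  by rewrite thinmx0 eqxx in v0_neq0.
(* The first row of this invertible matrix spans the line of [v0], so the change of basis turns the
   eigenvector into the coordinate vector [e]. *)
pose B : 'M[F]_(1 + n) := row_ebase v0.
have uB : B \in unitmx by exact: row_ebase_unit.
pose e : 'rV[F]_(1 + n) := row_mx 1%:M 0.
have [c0 c0_neq0 v0E] : exists2 c : F, c != 0 & v0 = c *: (e *m B).
  exists (col_ebase v0 0 0).
    have := col_ebase_unit v0; rewrite unitmxE det_mx11 unitfE //.
  rewrite -{1}(mulmx_ebase v0) rank_rV v0_neq0 -/B scalemxAl; congr (_ *m _).
  rewrite [col_ebase v0]mx11_scalar mul_scalar_mx -mx11_scalar; congr (_ *: _).
  by apply/rowP => i; rewrite !mxE; case: splitP => k ->; rewrite !mxE ?ord1.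
pose v := e *m B.
have vA : v *m A = x *: v.
  apply: (scalerI c0_neq0).
  by rewrite scalemxAl -v0E v0A v0E scalerA mulrC -scalerA.
pose Q := B *m A *m invmx B.
have QB : Q *m B = B *m A by rewrite mulmxKV.
have eQ : e *m Q = x *: e.
  by rewrite /Q !mulmxA vA -scalemxAl mulmxK.
pose L := dlsubmx (Q : 'M[F]_(1 + n)); pose D := drsubmx (Q : 'M[F]_(1 + n)).
have QE : Q = block_mx x%:M 0 L D.
  rewrite -[LHS](@submxK _ 1 n 1 n).
  have := eQ; rewrite -{1}[Q](@submxK _ 1 n 1 n) /e mul_row_block.
  rewrite !mul1mx !mul0mx !addr0 scale_row_mx scaler0 => /eq_row_mx[-> ->].
  by rewrite scalemx1.
have chE : char_poly A = ('X - x%:P) * char_poly D.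
  rewrite -(char_poly_conj A uB) -/Q QE /char_poly /char_poly_mx.
  rewrite (@map_block_mx _ _ polyC 1 n 1 n) map_mx0 (scalar_mx_block 1 n 'X).
  rewrite (@opp_block_mx _ 1 n 1 n) (@add_block_mx _ 1 n 1 n) oppr0 addr0.
  rewrite (@det_lblock _ 1 n); congr (_ * _).
  by rewrite det_mx11 !mxE eqxx !mulr1n.
have rD : root (char_poly D) x.
  have D0 : char_poly D != 0 by rewrite monic_neq0 ?char_poly_monic.
  apply/negPn/negP => /mupNroot nr; move: mx.
  by rewrite chE mupM ?polyXsubC_eq0 // nr addn0 -(expr1 ('X - _)) mup_XsubCX eqxx.
move: rD; rewrite -eigenvalue_root_char => /eigenvalueP[u uD u_neq0].
pose w' : 'rV[F]_(1 + n) := row_mx 0 u.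
exists v, (w' *m B), ((u *m L) 0 0); split=> //.
  rewrite -mulmxA -QB mulmxA QE /w' mul_row_block !mul0mx !add0r uD.
  rewrite /v !scalemxAl -mulmxDl /e !scale_row_mx !scaler0 add_row_mx.
  by rewrite add0r addr0 scalemx1 -mx11_scalar.
move=> k l; rewrite /v !scalemxAl -mulmxDl => /(congr1 (mulmx^~ (invmx B))).
rewrite mulmxK // mul0mx /e /w' !scale_row_mx add_row_mx !scaler0 addr0 add0r.
rewrite -(@row_mx0 _ 1 1 n) => /eq_row_mx[k0 l0]; split.
  by move/matrixP: k0 => /(_ 0 0); rewrite !mxE eqxx mulr1.
by move/eqP: l0; rewrite scaler_eq0 (negbTE u_neq0) orbF => /eqP.
Qed.

End MultipleRoot.

(** * The second eigenvalue through Rayleigh quotients *)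

Section SecondEigenvalue.
Variable R : realType.

(** The two largest eigenvalues either differ, and have independent eigenvectors, or form a double
    root, which might belong to a Jordan block; hence the coefficient [c]. *)
Lemma second_eig_eigenvectors n (A : 'M[R]_n) kappa :
  0 <= kappa -> kappa < second_eig A ->
  exists x y c : R, exists v w : 'rV[R]_n,
    [/\ kappa < y, y <= x, v *m A = x *: v, w *m A = y *: w + c *: v
      & (x != y -> c = 0) /\
        forall k l, k *: v + l *: w = 0 -> k = 0 /\ l = 0].
Proof.
move=> kappa0; rewrite /second_eig.
have srt : sorted (fun x y : R => y <= x) (eigs_desc A).
  by apply: sort_sorted => x y; apply: le_total.
have p0 : char_poly A != 0 by rewrite monic_neq0 ?char_poly_monic.
have mult_le z : (count_mem z (eigs_desc A) <= mup z (char_poly A))%N.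
  rewrite /eigs_desc /= count_sort count_flatten -map_comp sumnE big_map.
  rewrite (eq_bigr (fun x => (x == z) * mup x (char_poly A))%N); last first.
    by move=> x _; rewrite /= count_nseq.
  have [zr|zr] := boolP (z \in rootsR (char_poly A)).
    rewrite (bigD1_seq z) ?uniq_roots //= eqxx mul1n big1 ?addn0 //.
    by move=> x /negbTE->.
  rewrite big_seq big1 // => x xr; case: eqP => // xz.
  by rewrite -xz xr in zr.
have eig z : z \in eigs_desc A -> exists2 v : 'rV_n, v *m A = z *: v & v != 0.
  move=> zA; apply/eigenvalueP; rewrite eigenvalue_root_char.
  apply/negPn/negP => /mupNroot nr; have := mult_le z.
  by rewrite nr leqn0 -leqn0 leqNgt -has_count has_pred1 zA.
(* With fewer than two eigenvalues [second_eig] takes the default value 0, excluded by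
   [0 <= kappa]. *)
case: (eigs_desc A) srt mult_le eig => [|x [|y s]] /=; try by rewrite ltNge kappa0.
case/andP=> yx _ mult_le eig ky.
have [xy|xy] := eqVneq x y.
  have m2 : (1 < mup x (char_poly A))%N.
    by apply: leq_trans (mult_le x); rewrite xy !eqxx.
  have [v [w [c [vA wA ind]]]] := double_root_char_poly m2.
  by exists x, y, c, v, w; rewrite -xy; split => //; rewrite ?xy ?eqxx.
have [v vA v0] := eig x (mem_head _ _).
have [w wA w0] : exists2 v : 'rV_n, v *m A = y *: v & v != 0.
  by apply: eig; rewrite !inE eqxx orbT.
exists x, y, 0, v, w; split=> //; first by rewrite scale0r addr0.
split=> // k l kl.
have l0 : l = 0.
  have := congr1 (mulmx^~ A) kl; rewrite mul0mx mulmxDl -!scalemxAl vA wA.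
  rewrite scalerA mulrC -scalerA.
  have -> : k *: v = - (l *: w) by apply/eqP; rewrite -addr_eq0 kl.
  rewrite scalerN !scalerA -scaleNr -scalerDl => /eqP.
  rewrite scaler_eq0 (negbTE w0) orbF -mulNr (mulrC l) -mulrDl mulf_eq0.
  by rewrite addrC subr_eq0 eq_sym (negbTE xy) /= => /eqP.
split=> //; move/eqP: kl.
by rewrite l0 scale0r addr0 scaler_eq0 (negbTE v0) orbF => /eqP.
Qed.

(** A plane meets a hyperplane: take the coefficients [w *m z] and [- (v *m z)], or 1 and 0 if both
    vanish. *)
Lemma nontrivial_kernel_pair n (v w : 'rV[R]_n) (z : 'cV[R]_n) :
  exists k l : R, (k != 0) || (l != 0) /\ (k *: v + l *: w) *m z = 0.
Proof.
pose k := (w *m z) 0 0; pose l := - (v *m z) 0 0.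
have [h|] := boolP ((k != 0) || (l != 0)).
  exists k, l; split=> //; rewrite mulmxDl -!scalemxAl.
  rewrite [v *m z]mx11_scalar [w *m z]mx11_scalar !scale_scalar_mx -raddfD /=.
  by rewrite -/k -(opprK ((v *m z) 0 0)) -/l mulrN mulrC addNr raddf0.
rewrite negb_or !negbK oppr_eq0 => /andP[_ /eqP l0].
exists 1, 0; rewrite oner_neq0 scale1r scale0r addr0; split=> //.
by rewrite [LHS]mx11_scalar l0 raddf0.
Qed.

(** Courant-Fischer in codimension one: the plane of the top two eigenvectors contains a non-zero
    vector killed by [z], and its Rayleigh quotient is at least the second eigenvalue. *)
Lemma second_eig_le n (A : 'M[R]_n) (d : 'I_n -> R) (z : 'cV[R]_n) kappa :
  A^T = A -> (forall i, 0 < d i) -> 0 <= kappa ->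
  (forall f : 'rV[R]_n, f *m z = 0 ->
     qform A f <= kappa * \sum_i d i * f 0 i ^+ 2) ->
  second_eig (\matrix_(i, j) (A i j / d i)) <= kappa.
Proof.
move=> symA d0 k0 qA; rewrite leNgt; apply/negP.
set P := \matrix_(i, j) _ => /(second_eig_eigenvectors k0).
case=> x [y [c [v [w [ky yx vP wP [xyc ind]]]]]].
pose D : 'M[R]_n := diag_mx (\row_i d i).
pose E : 'M[R]_n := diag_mx (\row_i (d i)^-1).
have ED : E *m D = 1%:M.
  apply/matrixP => i j; rewrite mul_diag_mx !mxE.
  by case: eqP => [->|_]; rewrite ?mulr0 // !mulr1n mulVf ?gt_eqF.
have PE : P = E *m A.
  by apply/matrixP => i j; rewrite mul_diag_mx !mxE mulrC.
(* The row eigenvectors of [P = E *m A] become generalized eigenvectors for the two symmetric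
   matrices [A] and [D]. *)
pose f := v *m E; pose g := w *m E.
have fD : f *m D = v by rewrite /f -mulmxA ED mulmx1.
have gD : g *m D = w by rewrite /g -mulmxA ED mulmx1.
have fA : f *m A = x *: (f *m D) by rewrite fD -vP PE mulmxA.
have gA : g *m A = y *: (g *m D) + c *: (f *m D) by rewrite fD gD -wP PE mulmxA.
clearbody f g.
pose ip (f g : 'rV[R]_n) : R := (f *m D *m g^T) 0 0.
have ipC (f1 f2 : 'rV[R]_n) : ip f1 f2 = ip f2 f1.
  rewrite /ip; have -> : f1 *m D *m f2^T = (f2 *m D *m f1^T)^T.
    by rewrite !trmx_mul trmxK tr_diag_mx mulmxA.
  by rewrite mxE.
have ipE f1 : ip f1 f1 = \sum_i d i * f1 0 i ^+ 2.
  rewrite /ip mxE; apply: eq_bigr => i _.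
  by rewrite mul_mx_diag !mxE; ring.
have ip_ge0 f1 : 0 <= ip f1 f1.
  by rewrite ipE sumr_ge0 // => i _; rewrite mulr_ge0 ?sqr_ge0 // ltW.
have ip_gt0 f1 : f1 != 0 -> 0 < ip f1 f1.
  move=> f10; rewrite lt_def ip_ge0 andbT; apply: contra f10 => /eqP.
  rewrite ipE => /psumr_eq0P h; apply/eqP/rowP => i; rewrite mxE.
  have /eqP : d i * f1 0 i ^+ 2 = 0.
    by apply: h => // j _; rewrite mulr_ge0 ?sqr_ge0 // ltW.
  by rewrite mulf_eq0 gt_eqF //= sqrf_eq0 => /eqP.
have f_neq0 : f != 0.
  apply/eqP => f0; have := ind 1 0.
  rewrite scale1r scale0r addr0 -fD f0 mul0mx => /(_ erefl)[/eqP].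
  by rewrite oner_eq0.
(* The symmetry of [A] lets the pairing of [f] and [g] be evaluated from either side. This rules out
   a Jordan block and makes [f] and [g] orthogonal if [x != y]. *)
have symE : x * ip f g = y * ip f g + c * ip f f.
  have -> : x * ip f g = (f *m A *m g^T) 0 0 by rewrite fA -scalemxAl mxE.
  have -> : f *m A *m g^T = (g *m A *m f^T)^T.
    by rewrite !trmx_mul trmxK symA mulmxA.
  rewrite mxE gA mulmxDl -!scalemxAl.
  by rewrite [LHS]mxE [X in X + _]mxE [X in _ + X]mxE (ipC f g).
have c0 : c = 0.
  have [xy|/xyc//] := eqVneq x y.
  move: symE; rewrite xy => /eqP; rewrite -subr_eq0 opprD addrA subrr sub0r.
  by rewrite oppr_eq0 mulf_eq0 (gt_eqF (ip_gt0 _ f_neq0)) orbF => /eqP.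
have orth : (x - y) * ip f g = 0 by rewrite mulrBl symE c0 mul0r addr0 subrr.
have [k [l [kl hz]]] := nontrivial_kernel_pair f g z.
pose h := k *: f + l *: g.
have h_neq0 : h != 0.
  apply/eqP => h0; have := ind k l; rewrite -fD -gD.
  rewrite !scalemxAl -mulmxDl -/h h0 mul0mx => /(_ erefl)[k00 l00].
  by rewrite k00 l00 eqxx in kl.
have addE (B1 B2 : 'M[R]_1) : (B1 + B2) 0 0 = B1 0 0 + B2 0 0 by rewrite mxE.
have scaleE r (B1 : 'M[R]_1) : (r *: B1) 0 0 = r * B1 0 0 by rewrite mxE.
have hT : h^T = k *: f^T + l *: g^T by rewrite /h linearD !linearZ.
have hh : ip h h = k ^+ 2 * ip f f + 2 * (k * l) * ip f g + l ^+ 2 * ip g g.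
  rewrite /ip hT /h !mulmxDl !mulmxDr -!scalemxAl -!scalemxAr.
  rewrite !(addE, scaleE) -![(_ *m _ *m _) _ _]/(ip _ _) (ipC g f); ring.
have qh : qform A h = x * k ^+ 2 * ip f f + (x + y) * (k * l) * ip f g
    + y * l ^+ 2 * ip g g.
  rewrite /qform hT /h mulmxDl -!scalemxAl fA gA c0 scale0r addr0.
  rewrite !mulmxDl !mulmxDr -!scalemxAl -!scalemxAr.
  rewrite !(addE, scaleE) -![(_ *m _ *m _) _ _]/(ip _ _) (ipC g f); ring.
have := qA h hz; rewrite -ipE; apply/negP; rewrite -ltNge.
apply: (@lt_le_trans _ _ (y * ip h h)); first by rewrite ltr_pM2r ?ip_gt0.
have -> : qform A h = y * ip h h + (x - y) * (k ^+ 2 * ip f f)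
    + (k * l) * ((x - y) * ip f g) by rewrite qh hh; ring.
rewrite orth mulr0 addr0 lerDl mulr_ge0 ?subr_ge0 //.
by rewrite mulr_ge0 ?sqr_ge0 ?ip_ge0.
Qed.

End SecondEigenvalue.

(** * The link graph *)

Section EdgeMatrix.
Variables (R : realType) (V T : finType) (a b : T -> V).
Hypothesis a_neq_b : forall t, a t != b t.
Implicit Types (x : T -> R) (f : 'rV[R]_#|V|).

Definition joins u v t :=
  ((u == a t) && (v == b t)) || ((u == b t) && (v == a t)).

Lemma joinsE u v t : incident a b u t && (other_end a b u t == v) = joins u v t.
Proof.
rewrite /incident /other_end /joins; have [->|ua] /= := eqVneq u (a t).
  by rewrite (negbTE (a_neq_b t)) andFb orbF eq_sym.
by rewrite (eq_sym v (a t)).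
Qed.

Definition edge_matrix x : 'M[R]_#|V| :=
  \matrix_(i, j) \sum_(t | joins (enum_val i) (enum_val j) t) x t.

Lemma edge_matrix_sym x : (edge_matrix x)^T = edge_matrix x.
Proof.
apply/matrixP => i j; rewrite !mxE; apply: eq_bigl => t.
by rewrite /joins orbC; congr (_ || _); rewrite andbC.
Qed.

Lemma edge_matrix_exp x n i j :
  (edge_matrix x ^+ n) i j = walk_sum a b x n (enum_val i) (enum_val j).
Proof.
elim: n i => [|n IH] i; first by rewrite expr0 mxE /= (inj_eq enum_val_inj).
rewrite exprS -mulmxE mxE /=.
under eq_bigr do rewrite mxE IH mulr_suml.
rewrite (exchange_big_dep (incident a b (enum_val i))) /=; last first.
  by move=> k t _; rewrite -joinsE => /andP[].
apply: eq_bigr => t it.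
rewrite (big_pred1 (enum_rank (other_end a b (enum_val i) t))).
  by rewrite enum_rankK.
move=> k /=; rewrite -joinsE it /= -(inj_eq enum_val_inj) enum_rankK.
exact: eq_sym.
Qed.

Lemma trace_edge_matrix_exp x n :
  \tr (edge_matrix x ^+ n) = \sum_u walk_sum a b x n u u.
Proof.
rewrite /mxtrace (reindex _ (onW_bij _ (@enum_val_bij V))) /=.
by apply: eq_bigr => i _; apply: edge_matrix_exp.
Qed.

Lemma qform_edge_matrix x f : qform (edge_matrix x) f =
  2 * \sum_t x t * (f 0 (enum_rank (a t)) * f 0 (enum_rank (b t))).
Proof.
rewrite qformE.
under eq_bigr do under eq_bigr do rewrite mxE mulrAC big_distrr /=.
under eq_bigr do rewrite (exchange_big_dep xpredT) //=.
rewrite exchange_big mulr_sumr; apply: eq_bigr => t _ /=.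
pose ea := enum_rank (a t); pose eb := enum_rank (b t).
have eab : ea != eb by rewrite (inj_eq enum_rank_inj).
have evE k v : (enum_val k == v) = (k == enum_rank v).
  by rewrite -(inj_eq enum_val_inj) enum_rankK.
rewrite (bigD1 ea) //= [X in _ + X](bigD1 eb) /=; last by rewrite eq_sym.
rewrite [X in _ + (_ + X)]big1 ?addr0; last first.
  move=> i /andP[ia ib]; rewrite big1 // => j.
  by rewrite /joins !evE (negbTE ia) (negbTE ib).
rewrite (big_pred1 eb) => [|j]; last first.
  by rewrite /joins !evE eqxx (negbTE eab) orbF.
rewrite (big_pred1 ea) => [|j]; last first.
  by rewrite /joins !evE eqxx eq_sym (negbTE eab).
by ring.
Qed.

End EdgeMatrix.

(** * Connectedness from a spectral bound *)

Section WeightedGraph.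
Variables (R : realType) (V : finType) (w : V -> V -> nat).
Hypothesis w_sym : forall u v, w u v = w v u.

Definition weight_matrix : 'M[R]_#|V| :=
  \matrix_(i, j) (w (enum_val j) (enum_val i))%:R.

Definition weighted_degree v : nat := (\sum_u w u v)%N.

(* A vector constant on the connected components satisfies equality in
   [qform A f <= \sum_i d i * f 0 i ^+ 2]. *)
Lemma connect_spectral (z : 'cV[R]_#|V|) kappa :
  (forall v, (0 < weighted_degree v)%N) -> kappa < 1 ->
  (forall f : 'rV[R]_#|V|, f *m z = 0 -> qform weight_matrix f
     <= kappa * \sum_i (weighted_degree (enum_val i))%:R * f 0 i ^+ 2) ->
  forall u v, connect (fun x y => 0 < w x y)%N u v.
Proof.
move=> d0 k1 hq u v; apply/negPn/negP => uv.
set e : rel V := fun x y => (0 < w x y)%N.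
pose g : 'rV[R]_#|V| := \row_i (connect e u (enum_val i))%:R.
pose g' : 'rV[R]_#|V| := \row_i (~~ connect e u (enum_val i))%:R.
have [k [l [kl hz]]] := nontrivial_kernel_pair g g' z.
set h := k *: g + l *: g' in hz.
have hE i : h 0 i = if connect e u (enum_val i) then k else l.
  by rewrite !mxE; case: connect; rewrite /= ?mulr1 ?mulr0 ?addr0 ?add0r.
have hedge i j : (0 < w (enum_val j) (enum_val i))%N -> h 0 i = h 0 j.
  move=> wij; rewrite !hE; congr (if _ then _ else _).
  by apply/idP/idP => c; apply: connect_trans c (connect1 _); rewrite /e // w_sym.
have := hq h hz; have -> : qform weight_matrix h
    = \sum_i (weighted_degree (enum_val i))%:R * h 0 i ^+ 2.
  rewrite qformE; apply: eq_bigr => i _.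
  rewrite /weighted_degree natr_sum mulr_suml.
  rewrite [RHS](reindex _ (onW_bij _ (@enum_val_bij V))) /=.
  apply: eq_bigr => j _.
  have -> : weight_matrix i j = (w (enum_val j) (enum_val i))%:R by rewrite mxE.
  have [->|wij] := posnP (w (enum_val j) (enum_val i)).
    by ring.
  by rewrite (hedge _ _ wij); ring.
set q := \sum_i _; apply/negP; rewrite -ltNge.
suff q0 : 0 < q by rewrite gtr_pMl.
have t0 i : 0 <= (weighted_degree (enum_val i))%:R * h 0 i ^+ 2.
  by rewrite mulr_ge0 ?sqr_ge0.
rewrite lt_def sumr_ge0 ?andbT //.
apply: contraL kl => /eqP/psumr_eq0P => /(_ (fun i _ => t0 i)) q0.
have h0 x : h 0 (enum_rank x) = 0.
  have /eqP := q0 (enum_rank x) isT; rewrite mulf_eq0 pnatr_eq0 enum_rankK.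
  by rewrite gtn_eqF //= sqrf_eq0 => /eqP.
have := h0 u; have := h0 v; rewrite !hE !enum_rankK connect0 (negbTE uv).
by move=> -> ->; rewrite eqxx.
Qed.

End WeightedGraph.

(** * The link as a union of three bipartite graphs indexed by relators *)

Section LinkGraph.
Variables (R : realType) (m : nat).
Implicit Types (r : word m) (Rel : {set word m}) (t : 'I_3).

(** The three edges of a relator are the first edges of its cyclic rotations, so counts and sums for
    the [t]-th graph reduce to unrotated words. *)
Definition rotate r : word m := let: (i, j, k) := r in (j, k, i).

Lemma rotate_bij : bijective rotate.
Proof.
by exists (rotate \o rotate) => [[[i j] k]|[[i j] k]].
Qed.

Definition left_end t r : lvert m := inl (iter t rotate r).1.2.
Definition right_end t r : lvert m := inr (iter t rotate r).1.1.

Lemma left_neq_right t r : left_end t r != right_end t r.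
Proof. by []. Qed.

Lemma iter_rotate_bij n : bijective (iter n rotate).
Proof.
elim: n => [|n IH]; first by exists id.
by apply: eq_bij (bij_comp rotate_bij IH) _ _.
Qed.

Lemma card_iter_rotate n (P : pred (word m)) :
  #|[set r | P (iter n rotate r)]| = #|[set r | P r]|.
Proof.
rewrite -[RHS](on_card_preimset (onW_bij _ (iter_rotate_bij n))).
by apply: eq_card => r; rewrite !inE.
Qed.

Lemma card_incident t v :
  #|[set r | incident (left_end t) (right_end t) v r]| = (m ^ 2)%N.
Proof.
case: v => i; rewrite /incident /left_end /right_end.
  rewrite -[RHS](_ : #|[set r : word m | i == r.1.2]| = _); last first.
    have -> : [set r : word m | i == r.1.2]
        = finset.setX (finset.setX [set: 'I_m] [set i]) [set: 'I_m].
      by apply/setP => -[[x y] z]; rewrite !inE /= andbT eq_sym.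
    by rewrite !cardsX !cardsT card_ord cards1 muln1 mulnn.
  rewrite -(card_iter_rotate t (fun r => i == r.1.2)).
  by apply: eq_card => r; rewrite !inE orbF.
rewrite -[RHS](_ : #|[set r : word m | i == r.1.1]| = _); last first.
  have -> : [set r : word m | i == r.1.1]
      = finset.setX (finset.setX [set i] [set: 'I_m]) [set: 'I_m].
    by apply/setP => -[[x y] z]; rewrite !inE /= !andbT eq_sym.
  by rewrite !cardsX !cardsT card_ord cards1 mul1n mulnn.
rewrite -(card_iter_rotate t (fun r => i == r.1.1)).
by apply: eq_card => r; rewrite !inE.
Qed.

(** An edge fixes two letters of its relator and leaves the third free; vertices on the same side
    are never joined. *)
Lemma card_joins t u v :
  (#|[set r | joins (left_end t) (right_end t) u v r]| <= m)%N.
Proof.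
have cardij (i j : 'I_m) :
    #|[set r | (i == (iter t rotate r).1.2) && (j == (iter t rotate r).1.1)]| = m.
  rewrite (card_iter_rotate t (fun r => (i == r.1.2) && (j == r.1.1))).
  have -> : [set r : word m | (i == r.1.2) && (j == r.1.1)]
      = finset.setX [set (j, i)] [set: 'I_m].
    apply/setP => -[[x y] z]; rewrite !inE /= andbT xpair_eqE andbC.
    by rewrite (eq_sym j) (eq_sym i).
  by rewrite cardsX cardsT card_ord cards1 mul1n.
case: u v => [i|i] [j|j]; rewrite /joins /left_end /right_end.
- rewrite (_ : [set r | _] = finset.set0) ?cards0 //.
  by apply/setP => r; rewrite !inE andbF.
- rewrite -[leqRHS](cardij i j); apply/subset_leq_card/fintype.subsetP => r.
  by rewrite !inE orbF.
- rewrite -[leqRHS](cardij j i); apply/subset_leq_card/fintype.subsetP => r.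
  by rewrite !inE /= andbC.
- rewrite (_ : [set r | _] = finset.set0) ?cards0 //.
  by apply/setP => r; rewrite !inE andbF.
Qed.

Lemma link_multE Rel u v : link_mult Rel u v =
  (\sum_t \sum_(r in Rel) joins (left_end t) (right_end t) u v r)%N.
Proof.
rewrite exchange_big; apply: eq_bigr => -[[i j] k] _.
rewrite !big_ord_recl big_ord0 /=.
by rewrite /joins /left_end /right_end /= !xpair_eqE !(eq_sym u) !(eq_sym v)
  !(andbC (_ == v)).
Qed.

Lemma link_mult_sym Rel u v : link_mult Rel u v = link_mult Rel v u.
Proof.
by apply: eq_bigr => r _; apply: eq_count => e; rewrite /= orbC.
Qed.

Lemma link_degE Rel v : link_deg Rel v = (\sum_(t < 3)
  #|[set r in Rel | incident (left_end t) (right_end t) v r]|)%N.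
Proof.
rewrite /link_deg; under eq_bigr do rewrite link_mult_sym link_multE.
rewrite exchange_big; apply: eq_bigr => t _ /=.
rewrite exchange_big -sum1_card big_mkcond /= [RHS]big_mkcond /=.
apply: eq_bigr => r _; rewrite inE; case: (r \in Rel) => //=.
have lr := left_neq_right t.
under eq_bigr do rewrite -(joinsE lr).
have [ir|_] := boolP (incident _ _ v r); last by rewrite big1.
rewrite (bigD1 (other_end (left_end t) (right_end t) v r)) //= eqxx.
by rewrite big1 ?addn0 // => y; rewrite eq_sym => /negbTE->.
Qed.

Definition link_edge_matrix t (x : word m -> R) :=
  edge_matrix (left_end t) (right_end t) x.

Definition left_indicator : 'cV[R]_#|lvert m| :=
  \col_i (if enum_val i is inl _ then 1 else 0).

(** Centering subtracts from each form a multiple of the complete bipartite one, which has the sum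
    of [f] over the left vertices as a factor. *)
Lemma qform_link p Rel f : f *m left_indicator = 0 ->
  qform (weight_matrix R (link_mult Rel)) f
  = \sum_t qform (link_edge_matrix t (centered p Rel)) f.
Proof.
move=> fz.
have fz' : \sum_(i : 'I_m) f 0 (enum_rank (inl i : lvert m)) = 0.
  have := congr1 (fun M : 'M[R]_1 => M 0 0) fz; rewrite !mxE.
  rewrite (reindex _ (onW_bij _ (@enum_rank_bij (lvert m)))) /=.
  rewrite big_sumType /= [X in _ + X]big1 ?addr0 => [|i _].
    by under eq_bigr do rewrite !mxE enum_rankK mulr1.
  by rewrite !mxE enum_rankK mulr0.
transitivity (\sum_t qform (link_edge_matrix t (fun r => (r \in Rel)%:R)) f).
  rewrite qformE; under [RHS]eq_bigr do rewrite qformE.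
  rewrite [RHS]exchange_big; apply: eq_bigr => i _ /=.
  rewrite [RHS]exchange_big; apply: eq_bigr => j _ /=.
  rewrite -mulr_suml -mulr_sumr; congr (_ * _ * _).
  rewrite mxE link_mult_sym link_multE natr_sum; apply: eq_bigr => t _.
  rewrite mxE natr_sum big_mkcond [RHS]big_mkcond; apply: eq_bigr => r _ /=.
  by case: (r \in Rel); case: joins.
apply: eq_bigr => t _.
rewrite !(qform_edge_matrix (left_neq_right t)); congr (_ * _).
apply/eqP; rewrite -subr_eq0 -sumrB.
have -> : \sum_r ((r \in Rel)%:R * (f 0 (enum_rank (left_end t r)) *
      f 0 (enum_rank (right_end t r))) - centered p Rel r *
      (f 0 (enum_rank (left_end t r)) * f 0 (enum_rank (right_end t r))))
   = p * \sum_r (f 0 (enum_rank (left_end t r)) *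
      f 0 (enum_rank (right_end t r))).
  by rewrite mulr_sumr; apply: eq_bigr => r _; rewrite /centered; ring.
suff -> : \sum_r (f 0 (enum_rank (left_end t r)) *
      f 0 (enum_rank (right_end t r))) = 0 by rewrite mulr0.
transitivity (\sum_(r : word m) f 0 (enum_rank (inl r.1.2 : lvert m)) *
      f 0 (enum_rank (inr r.1.1 : lvert m))).
  by rewrite [RHS](reindex _ (onW_bij _ (iter_rotate_bij t))).
rewrite -(pair_big xpredT xpredT (fun (ij : 'I_m * 'I_m) (k : 'I_m) =>
   f 0 (enum_rank (inl ij.2 : lvert m)) * f 0 (enum_rank (inr ij.1 : lvert m)))) /=.
rewrite exchange_big big1 // => k _ /=.
rewrite -(pair_big xpredT xpredT (fun (i j : 'I_m) =>
   f 0 (enum_rank (inl j : lvert m)) * f 0 (enum_rank (inr i : lvert m)))) /=.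
by apply: big1 => i _; rewrite -mulr_suml fz' mul0r.
Qed.

(** Three forms bounded by [6 * s] give [18 * s], and three degree bounds give [2 * s ^+ 2]; the
    ratio is [9 / s]. It is below 1, as connectedness requires, and strictly below [10 / s]. *)
Lemma link_good (p s : R) Rel : 9 < s ->
  (forall t f, qform (link_edge_matrix t (centered p Rel)) f
     <= 6 * s * normsq f) ->
  (forall t v, 2 / 3 * s ^+ 2
     <= #|[set r in Rel | incident (left_end t) (right_end t) v r]|%:R) ->
  link_connected Rel && (second_eig (rw_matrix R Rel) < 10 / s).
Proof.
move=> s9 hq hd; have s0 : 0 < s by lra.
have deg_ge v : 2 * s ^+ 2 <= (link_deg Rel v)%:R.
  rewrite link_degE natr_sum.
  apply: (@le_trans _ _ (\sum_(t < 3) 2 / 3 * s ^+ 2)).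
    by rewrite big_const iter_addr_0 card_ord; lra.
  by apply: ler_sum => t _; apply: hd.
have degE v : link_deg Rel v = weighted_degree (link_mult Rel) v by [].
have qA f : f *m left_indicator = 0 -> qform (weight_matrix R (link_mult Rel)) f
    <= 9 / s * \sum_i (link_deg Rel (enum_val i))%:R * f 0 i ^+ 2.
  move=> fz; rewrite (qform_link p _ fz).
  apply: (@le_trans _ _ (\sum_(t < 3) 6 * s * normsq f)).
    by apply: ler_sum => t _; apply: hq.
  apply: (@le_trans _ _ (9 / s * (2 * s ^+ 2 * normsq f))).
    rewrite big_const iter_addr_0 card_ord.
    suff -> : 9 / s * (2 * s ^+ 2 * normsq f) = 18 * s * normsq f by lra.
    by field; rewrite gt_eqF.
  apply: ler_wpM2l; first by rewrite divr_ge0 // ltW.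
  rewrite /normsq mulr_sumr; apply: ler_sum => i _.
  by rewrite ler_wpM2r ?sqr_ge0.
have deg_gt0 v : (0 < link_deg Rel v)%N.
  by rewrite -(ltr0n R) (lt_le_trans _ (deg_ge v)) // mulr_gt0 ?exprn_gt0.
apply/andP; split.
  apply/forallP => u; apply/forallP => v.
  apply: (connect_spectral (link_mult_sym Rel) (kappa := 9 / s)
     (z := left_indicator)) => //.
  by rewrite ltr_pdivrMr // mul1r.
apply: (@le_lt_trans _ _ (9 / s)); last by rewrite ltr_pM2r ?invr_gt0 //; lra.
have := second_eig_le (A := weight_matrix R (link_mult Rel))
  (d := fun i => (link_deg Rel (enum_val i))%:R) (z := left_indicator)
  (kappa := 9 / s).
have -> : \matrix_(i, j) (weight_matrix R (link_mult Rel) i j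
     / (link_deg Rel (enum_val i))%:R) = rw_matrix R Rel.
  by apply/matrixP => i j; rewrite !mxE.
apply => //.
- by apply/matrixP => i j; rewrite !mxE link_mult_sym.
- by move=> i; rewrite ltr0n.
- by rewrite divr_ge0 // ltW.
Qed.

End LinkGraph.

(** * Probability estimates *)

Section LinkProbability.
Variable R : realType.

Lemma prob_pos_triE m (p : R) (E : pred {set word m}) :
  prob_pos_tri m p E = expect p (fun S => (E S)%:R).
Proof.
rewrite /prob_pos_tri big_mkcond; apply: eq_bigr => S _.
by case: (E S); rewrite /= ?mulr1 ?mulr0.
Qed.

Lemma prob_pos_tri_le1 m (p : R) (E : pred {set word m}) :
  0 <= p <= 1 -> prob_pos_tri m p E <= 1.
Proof.
move=> p01; rewrite prob_pos_triE -[leRHS](@expect1 R (word m) p).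
by apply: ler_expect => // S; case: (E S).
Qed.

Lemma sym_mx_exp n (A : 'M[R]_n) k : A^T = A -> (A ^+ k)^T = A ^+ k.
Proof.
move=> symA; elim: k => [|k IH]; first by rewrite expr0 trmx1.
by rewrite [in LHS]exprS -mulmxE trmx_mul IH symA mulmxE -exprSr.
Qed.

Lemma trace_even_ge0 n (A : 'M[R]_n) j : A^T = A -> 0 <= \tr (A ^+ (2 ^ j.+1)).
Proof.
move=> symA; rewrite expnSr exprM; set B := A ^+ _.
have symB : B^T = B by exact: sym_mx_exp.
apply: sumr_ge0 => i _; rewrite expr2 -mulmxE mxE sumr_ge0 // => k _.
by rewrite -{2}symB mxE -expr2 sqr_ge0.
Qed.

(** Exponential moment at parameter [1 / 3] for the event that [S] has fewer than [2 / 3 * D]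
    elements in [Q]: the factor with [2 / 9] makes the integrand exceed 1 there, and [q <= 3 / 4]
    leaves the exponent [2 / 9 * D - D / 4 = - (D / 36)]. *)
Lemma expect_chernoff (T : finType) (p : R) (Q : {set T}) (D : R) :
  0 <= p <= 1 -> #|Q|%:R * p = D ->
  expect p (fun S => expR (2 / 9 * D) * expR (- (1 / 3)) ^+ #|S :&: Q|)
  <= expR (- (D / 36)).
Proof.
move=> /andP[p0 p1] QD; set q := expR (- (1 / 3)).
have q34 : q <= 3 / 4.
  rewrite /q expRN -[leRHS]invrK lef_pV2 ?posrE ?expR_gt0 ?invr_gt0 ?divr_gt0 //.
  have -> : (3 / 4)^-1 = 1 + 1 / 3 :> R by field.
  exact: expR_ge1Dx.
have q0 : 0 <= q by exact: expR_ge0.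
rewrite expectZ.
have -> : expect p (fun S => q ^+ #|S :&: Q|) = (p * q + (1 - p)) ^+ #|Q|.
  pose g t (c : bool) : R := if c && (t \in Q) then q else 1.
  transitivity (expect p (fun S => \prod_t g t (t \in S))).
    apply: eq_bigr => S _; congr (_ * _).
    rewrite /g -big_mkcond /= -prodr_const; apply: eq_bigl => t.
    by rewrite inE.
  rewrite (expect_prod p g) -prodr_const [RHS]big_mkcond /=.
  by apply: eq_bigr => t _; rewrite /g; case: (t \in Q) => /=; ring.
apply: (@le_trans _ _ (expR (2 / 9 * D) * expR (- (p * (1 - q))) ^+ #|Q|)).
  rewrite ler_wpM2l ?expR_ge0 // lerXn2r ?nnegrE ?expR_ge0 //.
    by rewrite addr_ge0 ?mulr_ge0 // subr_ge0.
  have -> : p * q + (1 - p) = 1 + - (p * (1 - q)) by ring.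
  exact: expR_ge1Dx.
rewrite -expRM_natl -expRD ler_expR.
have -> : #|Q|%:R * - (p * (1 - q)) = - (D * (1 - q)) by rewrite -QD; ring.
have D0 : 0 <= D by rewrite -QD mulr_ge0.
by nra.
Qed.

(** Markov's inequality and the union bound at once: if the link is not good, some term of the
    non-negative [F] is at least 1, so the expectation of [F] bounds the failure probability. *)
Lemma prob_link_good m (p s : R) (j : nat) (N := (2 ^ j.+1)%N) :
  (0 < m)%N -> 0 <= p <= 1 -> 9 < s -> (m ^ 2)%:R * p = s ^+ 2 ->
  2 * N%:R ^+ 3 * (m%:R * p) + N%:R ^+ 2 * s <= s ^+ 2 ->
  (m ^ 2 <= 2 ^ N)%N -> (m ^ 2)%:R <= expR (s ^+ 2 / 36) ->
  1 - 12 / m%:R <= prob_pos_tri m p (fun Rel => link_connected Rel &&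
      (second_eig (rw_matrix R Rel) < 10 / s)).
Proof.
move=> m0 p01 s9 ms mN mN2 ms2; have s0 : 0 < s by lra.
set good := (X in prob_pos_tri _ _ X).
pose H t (S : {set word m}) := link_edge_matrix t (centered p S).
pose F1 t S : R := \tr (H t S ^+ N) / (6 * s) ^+ N.
pose Q (t : 'I_3) v : {set word m} :=
  [set r | incident (left_end t) (right_end t) v r].
pose F2 t v S : R :=
  expR (2 / 9 * s ^+ 2) * expR (- (1 / 3)) ^+ #|S :&: Q t v|.
have symH t S : (H t S)^T = H t S by exact: edge_matrix_sym.
have s6 : 0 < (6 * s) ^+ N by rewrite exprn_gt0 ?mulr_gt0.
have F1_ge0 t S : 0 <= F1 t S.
  by rewrite divr_ge0 ?trace_even_ge0 // ltW.
have F2_ge0 t v S : 0 <= F2 t v S by rewrite mulr_ge0 ?exprn_ge0 ?expR_ge0.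
pose F S := \sum_t F1 t S + \sum_t \sum_v F2 t v S.
have F_ge0 S : 0 <= F S.
  rewrite addr_ge0 ?sumr_ge0 // => t _; exact: sumr_ge0.
have badF S : 1 <= (good S)%:R + F S.
  rewrite leNgt; apply/negP => F1lt.
  have Flt : F S < 1 by apply: le_lt_trans F1lt; rewrite lerDr.
  have F1_lt t : F1 t S < 1.
    apply: le_lt_trans Flt; rewrite /F (bigD1 t) //= -addrA lerDl addr_ge0 //.
      exact: sumr_ge0.
    by apply: sumr_ge0 => t' _; apply: sumr_ge0.
  have F2_lt t v : F2 t v S < 1.
    apply: le_lt_trans Flt; rewrite /F addrC (bigD1 t) //= (bigD1 v) //=.
    rewrite -!addrA lerDl !addr_ge0 ?sumr_ge0 // => t' _; exact: sumr_ge0.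
  suff gS : good S by rewrite gS ltNge lerDl F_ge0 in F1lt.
  apply: (link_good (p := p)) => // [t f|t v].
    rewrite leNgt; apply/negP => lt_f.
    have q0 : 0 <= 6 * s * normsq f.
      by rewrite mulr_ge0 ?normsq_ge0 // mulr_ge0 // ltW.
    have := qform_trace_le f j (symH t S); apply/negP; rewrite -ltNge -/N.
    apply: (@le_lt_trans _ _ ((6 * s * normsq f) ^+ N)).
      rewrite [leRHS]exprMn mulrC ler_wpM2r ?exprn_ge0 ?normsq_ge0 //.
      by have := F1_lt t; rewrite ltr_pdivrMr // mul1r => /ltW.
    by rewrite ltrXn2r ?expn_eq0 // nnegrE ?(le_trans q0 (ltW lt_f)).
  rewrite leNgt; apply/negP => lt_v.
  have := F2_lt t v; apply/negP; rewrite -leNgt /F2.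
  rewrite -expRM_natl -expRD -[leLHS]expR0 ler_expR.
  have -> : #|S :&: Q t v|
      = #|[set r in S | incident (left_end t) (right_end t) v r]|.
    by apply: eq_card => r; rewrite !inE.
  by lra.
have {badF} : 1 <= prob_pos_tri m p good + expect p F.
  rewrite prob_pos_triE -expectD -[leLHS](@expect1 R (word m) p).
  by apply: ler_expect.
(* The three traces contribute [2 / m] each, and the [3 * (2 * m)] degree terms at most [1 / m ^+ 2]
   each. *)
suff EF : expect p F <= 12 / m%:R by lra.
have cardV : #|lvert m|%:R = 2 * m%:R :> R.
  by rewrite card_sum card_ord addnn -mul2n natrM.
have sumV (c : R) : \sum_(v : lvert m) c = 2 * m%:R * c.
  by rewrite sumr_const -cardV [RHS]mulr_natl; congr (_ *+ _); apply: eq_card.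
have m_neq0 : m%:R != 0 :> R by rewrite pnatr_eq0 -lt0n.
have m_gt0 : 0 < m%:R :> R by rewrite ltr0n.
have EF1 t : expect p (F1 t) <= 2 / m%:R.
  have -> : expect p (F1 t) = (6 * s) ^- N * \sum_(v : lvert m)
      expect p (fun S : {set word m} =>
        walk_sum (left_end t) (right_end t) (centered p S) N v v).
    rewrite -expect_sum -expectZ; apply: eq_bigr => S _.
    congr (_ * _); rewrite /F1 /H /link_edge_matrix.
    by rewrite (trace_edge_matrix_exp (left_neq_right t)) mulrC.
  rewrite ler_pdivrMl // mulrC.
  apply: (@le_trans _ _ (\sum_(v : lvert m) 3 ^+ N * s ^+ N)).
    apply: ler_sum => v _.
    apply: (@expect_walk_sum_le _ _ _ _ _ (left_neq_right t) p s (m ^ 2) m) => //.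
    - by rewrite expn_gt0.
    - by move=> u; rewrite card_incident.
    - move=> u y; apply: leq_trans (card_joins t u y).
      apply/subset_leq_card/fintype.subsetP => r.
      by rewrite !inE (joinsE (left_neq_right t)).
  rewrite sumV.
  (* Allowing 6 in place of 3 gains [2 ^+ N], at least [m ^+ 2], against the [2 * m] terms of the
     trace. *)
  have -> : (6 * s) ^+ N = 2 ^+ N * (3 ^+ N * s ^+ N).
    by rewrite -!exprMn; congr (_ ^+ _); ring.
  rewrite [leRHS]mulrA; apply: ler_wpM2r.
    by rewrite mulr_ge0 ?exprn_ge0 // ltW.
  rewrite [leRHS]mulrAC -[leRHS]mulrA; apply: ler_wpM2l => //.
  by rewrite ler_pdivlMr // -natrM mulnn -natrX ler_nat.
have EF2 t v : expect p (F2 t v) <= (m%:R ^+ 2)^-1.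
  apply: le_trans (expect_chernoff p01 _) _.
    by rewrite card_incident.
  by rewrite expRN lef_pV2 ?posrE ?expR_gt0 ?exprn_gt0 // -natrX.
rewrite expectD !expect_sum.
apply: (@le_trans _ _ (\sum_(t < 3) 2 / m%:R
    + \sum_(t < 3) \sum_(v : lvert m) (m%:R ^+ 2)^-1)).
  apply: lerD; first by apply: ler_sum.
  apply: ler_sum => t _; rewrite expect_sum; exact: ler_sum.
under [X in _ + X]eq_bigr do rewrite sumV.
rewrite !sumr_const card_ord.
have -> : 2 * m%:R * (m%:R ^+ 2)^-1 = 2 / m%:R :> R by field.
lra.
Qed.

End LinkProbability.

(** * Choice of the walk length and estimates for large [m] *)

Local Open Scope classical_set_scope.
Local Open Scope ring_scope.

Section Asymptotics.
Variable R : realType.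

Lemma powR_ln_le (eta x : R) : 0 < eta -> 1 <= x -> ln x <= x `^ eta / eta.
Proof.
move=> eta0 x1; rewrite ler_pdivlMr // mulrC -ln_powR.
have y0 : 0 < x `^ eta by rewrite powR_gt0 // (lt_le_trans ltr01).
have := @le_ln1Dx R (x `^ eta - 1).
have -> : 1 + (x `^ eta - 1) = x `^ eta by ring.
have -> : -1 < x `^ eta - 1 by lra.
by move=> /(_ isT); lra.
Qed.

(** The length is a power of two between [2 * L] and [4 * L], with [L] about the binary logarithm of
    [m]; a small power of [m] absorbs the logarithm. *)
Lemma walk_length_exists (eta : R) (m : nat) : 0 < eta -> (0 < m)%N ->
  exists j, (m ^ 2 <= 2 ^ (2 ^ j.+1))%N /\
    (2 ^ j.+1)%:R <= 4 * (1 + (eta * ln 2)^-1) * m%:R `^ eta.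
Proof.
move=> eta0 m0; have m1 : 1 <= m%:R :> R by rewrite ler1n.
pose L := (trunc_log 2 m).+1; exists (trunc_log 2 L.*2).
have mL : (m < 2 ^ L)%N by apply: trunc_log_ltn.
have L0 : (0 < L.*2)%N by rewrite double_gt0.
split.
  apply: (@leq_trans (2 ^ L.*2)%N).
    by rewrite -muln2 expnM leq_sqr ltnW.
  by rewrite leq_exp2l // ltnW // trunc_log_ltn.
apply: (@le_trans _ _ (4 * L%:R)).
  rewrite -(natrM _ 4) ler_nat expnS.
  have := trunc_logP (isT : (1 < 2)%N) L0; rewrite -mul2n.
  by lia.
rewrite -mulrA ler_wpM2l //.
have y1 : 1 <= m%:R `^ eta.
  by rewrite -[leLHS](powRr0 m%:R) ler_powR // ltW.
have ln2 : 0 < ln 2 :> R by rewrite ln_gt0 // ltr1n.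
rewrite /L -natr1 addrC mulrDl mul1r lerD // mulrC invfM mulrA.
rewrite ler_pdivlMr //; apply: le_trans (powR_ln_le eta0 m1).
rewrite mulr_natl -lnXn // ler_ln ?posrE ?exprn_gt0 ?ltr0n //.
by rewrite -natrX ler_nat trunc_logP.
Qed.

(** Everything is expressed through [y], the power of [m] with exponent [eta]: [s = c * y ^+ 4] and
    [p = C * y ^+ 8 / m ^+ 2], while the walk length is at most [K * y]. *)
Lemma link_parameters (alpha C : R) : 3 / 2 < alpha -> alpha < 2 -> 0 < C ->
  \forall m \near \oo, exists j : nat,
  let p := C / m%:R `^ alpha in
  let s := Num.sqrt C * m%:R `^ (1 - alpha / 2) in
  let N := (2 ^ j.+1)%N in
  [/\ (0 < m)%N, 0 <= p <= 1, 9 < s, (m ^ 2)%:R * p = s ^+ 2 &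
  [/\ 2 * N%:R ^+ 3 * (m%:R * p) + N%:R ^+ 2 * s <= s ^+ 2,
     (m ^ 2 <= 2 ^ N)%N & (m ^ 2)%:R <= expR (s ^+ 2 / 36) ]].
Proof.
move=> a32 a2 C0; pose eta := (2 - alpha) / 8; pose c := Num.sqrt C.
have eta0 : 0 < eta by rewrite /eta; lra.
have c0 : 0 < c by rewrite sqrtr_gt0.
have cC : c ^+ 2 = C by rewrite sqr_sqrtr // ltW.
pose K : R := 4 * (1 + (eta * ln 2)^-1).
have ln2 : 0 < ln 2 :> R by rewrite ln_gt0 // ltr1n.
have K0 : 0 < K by rewrite mulr_gt0 // addr_gt0 // invr_gt0 mulr_gt0.
(* The summands serve, in order, [1 <= y], the bounds [first_le] and [second_le], [9 < s], the
   exponential bound and [p <= 1]. *)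
pose Y : R := 1 + 4 * K ^+ 3 + 2 * K ^+ 2 / c + 10 / c + 72 / (eta * C) + C.
have K3 : 0 < K ^+ 3 by rewrite exprn_gt0.
have K2c : 0 < 2 * K ^+ 2 / c by rewrite divr_gt0 // mulr_gt0 // exprn_gt0.
have c10 : 0 < 10 / c by rewrite divr_gt0.
have e72 : 0 < 72 / (eta * C) by rewrite divr_gt0 // mulr_gt0.
near=> m.
have m0 : (0 < m)%N by near: m; exists 1%N.
have m1 : 1 <= m%:R :> R by rewrite ler1n.
have mR0 : 0 < m%:R :> R by rewrite ltr0n.
pose y := m%:R `^ eta.
have yY : Y <= y.
  have mY : Y `^ eta^-1 <= m%:R by near: m; exact: nbhs_infty_ger.
  have Y0 : 0 <= Y by rewrite /Y; lra.
  rewrite /y; have -> : Y = (Y `^ eta^-1) `^ eta.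
    by rewrite -powRrM mulVf ?gt_eqF // powRr1.
  by rewrite ge0_ler_powR ?nnegrE ?powR_ge0 // ltW.
have c910 : 9 / c < 10 / c by rewrite ltr_pM2r ?invr_gt0 // ltr_nat.
rewrite /Y in yY; have Y1 : 1 <= y by lra.
have YK : 4 * K ^+ 3 <= y by lra.
have YKc : 2 * K ^+ 2 / c <= y by lra.
have Yc : 9 / c < y by lra.
have Ye : 72 / (eta * C) <= y by lra.
have YC : C <= y by lra.
have y0 : 0 < y by lra.
have yX n : y ^+ n = m%:R `^ (eta * n%:R).
  by rewrite powRrM powR_mulrn // powR_ge0.
(* As [16 * eta = 2 * (2 - alpha)], this is where [3 / 2 < alpha] enters. *)
have y16 : y ^+ 16 <= m%:R.
  rewrite yX -[leRHS]powRr1 ?(ltW mR0) //; apply: ler_powR => //.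
  by rewrite /eta; lra.
have [j [mN NK]] := walk_length_exists eta0 m0.
rewrite -/K -/y in NK.
exists j; cbv zeta; set p := C / _; set s := Num.sqrt C * _.
set N := (2 ^ j.+1)%N; rewrite -/N in mN NK.
have sE : s = c * y ^+ 4 by rewrite yX /s /c /eta; congr (_ * _ `^ _); field.
have s2 : s ^+ 2 = C * y ^+ 8 by rewrite sE exprMn cC -exprM.
have pE : p = C * y ^+ 8 / m%:R ^+ 2.
  have -> : p = C * (m%:R `^ alpha)^-1 by [].
  rewrite -mulrA; congr (_ * _).
  have -> : m%:R ^+ 2 = y ^+ 8 * m%:R `^ alpha.
    rewrite yX -powRD; last by rewrite (gt_eqF mR0) implybT.
    by rewrite -powR_mulrn ?ltW // /eta; congr (_ `^ _); field.
  by rewrite invfM mulrA divff ?mul1r // expf_neq0 // gt_eqF.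
have yn1 n : 1 <= y ^+ n by rewrite exprn_ege1.
have yn0 n : 0 < y ^+ n by rewrite exprn_gt0.
have y_le n : y <= y ^+ n.+1 by rewrite exprS ler_peMr // ltW.
have m20 : 0 < m%:R ^+ 2 :> R by rewrite exprn_gt0.
split=> //; last split=> //.
- rewrite pE; apply/andP; split.
    by rewrite divr_ge0 ?mulr_ge0 ?ltW.
  rewrite ler_pdivrMr // mul1r.
  apply: (@le_trans _ _ (y ^+ 16 * y ^+ 16)); last first.
    by rewrite expr2 ler_pM // ltW.
  rewrite -exprD (exprD y 24 8); apply: ler_wpM2r; first exact: ltW.
  exact: le_trans YC (y_le _).
- rewrite sE; apply: (@lt_le_trans _ _ (c * y)).
    by rewrite mulrC -ltr_pdivrMr.
  by rewrite ler_wpM2l ?y_le // ltW.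
- by rewrite s2 pE natrX; field; rewrite gt_eqF.
- have N0 : 0 <= N%:R :> R by rewrite ler0n.
  have Ky0 : 0 <= K * y by rewrite mulr_ge0 // ltW.
  have N3 : N%:R ^+ 3 <= K ^+ 3 * y ^+ 3 by rewrite -exprMn lerXn2r.
  have N2 : N%:R ^+ 2 <= K ^+ 2 * y ^+ 2 by rewrite -exprMn lerXn2r.
  have mp : m%:R * p = C * y ^+ 8 / m%:R by rewrite pE; field; rewrite gt_eqF.
  have first_le : 2 * N%:R ^+ 3 * (m%:R * p) <= s ^+ 2 / 2.
    rewrite mp s2.
    have -> : 2 * N%:R ^+ 3 * (C * y ^+ 8 / m%:R)
       = C * y ^+ 8 / 2 * (4 * N%:R ^+ 3 / m%:R) by field; rewrite gt_eqF.
    have c8 : 0 <= C * y ^+ 8 / 2 by rewrite divr_ge0 // mulr_ge0 // ltW.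
    rewrite ler_piMr // ler_pdivrMr // mul1r.
    apply: le_trans y16.
    apply: (@le_trans _ _ (4 * K ^+ 3 * y ^+ 3)); first by rewrite -mulrA ler_wpM2l.
    rewrite (exprD y 13 3); apply: ler_wpM2r; first exact: ltW.
    exact: le_trans YK (y_le _).
  have second_le : N%:R ^+ 2 * s <= s ^+ 2 / 2.
    rewrite [s ^+ 2]expr2 [leRHS]mulrAC; apply: ler_wpM2r.
      by rewrite sE mulr_ge0 // ltW.
    apply: le_trans N2 _; rewrite sE.
    have -> : c * y ^+ 4 / 2 = c / 2 * y ^+ 2 * y ^+ 2 by field.
    apply: ler_wpM2r; first exact: ltW.
    rewrite -[leLHS](_ : 2 * K ^+ 2 / c * (c / 2) = _); last by field; rewrite gt_eqF.
    rewrite mulrC; apply: ler_wpM2l; first by rewrite divr_ge0 // ltW.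
    exact: le_trans YKc (y_le _).
  lra.
- rewrite -[leLHS]lnK ?posrE ?ltr0n ?expn_gt0 ?m0 // ler_expR.
  rewrite natrX lnXn // s2 -[leLHS]mulr_natl.
  have := powR_ln_le eta0 m1; rewrite -/y => lnm.
  apply: (@le_trans _ _ (2 * (y / eta))); first exact: ler_wpM2l.
  rewrite ler_pdivlMr //.
  have -> : 2 * (y / eta) * 36 = C * (72 / (eta * C) * y).
    by field; rewrite !gt_eqF.
  apply: ler_wpM2l; first exact: ltW.
  rewrite (exprD y 7 1) expr1; apply: ler_wpM2r; first exact: ltW.
  exact: le_trans Ye (y_le _).
Unshelve. all: by end_near.
Qed.

End Asymptotics.

Theorem theorem4p15 (R : realType) (alpha C : R) :
  3 / 2 < alpha -> alpha < 2 -> 0 < C ->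
  (fun m : nat =>
     prob_pos_tri m (C / (m%:R `^ alpha))
       (fun Rel => link_connected Rel &&
          (second_eig (rw_matrix R Rel)
             < 10 / (Num.sqrt C * m%:R `^ (1 - alpha / 2)))))
    @ \oo --> (1 : R).
Proof.
move=> a32 a2 C0; apply/cvgrPdist_le => e e0.
near=> m.
have [j [m0 p01 s9 ms [mN mN2 ms2]]] : exists j : nat,
  let p := C / m%:R `^ alpha in
  let s := Num.sqrt C * m%:R `^ (1 - alpha / 2) in
  let N := (2 ^ j.+1)%N in
  [/\ (0 < m)%N, 0 <= p <= 1, 9 < s, (m ^ 2)%:R * p = s ^+ 2 &
  [/\ 2 * N%:R ^+ 3 * (m%:R * p) + N%:R ^+ 2 * s <= s ^+ 2,
     (m ^ 2 <= 2 ^ N)%N & (m ^ 2)%:R <= expR (s ^+ 2 / 36) ]].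
  by near: m; exact: link_parameters.
have em : 12 / m%:R <= e.
  have : 12 / e <= m%:R by near: m; exact: nbhs_infty_ger.
  by rewrite !ler_pdivrMr ?ltr0n // mulrC.
have := prob_link_good m0 p01 s9 ms mN mN2 ms2.
set P := prob_pos_tri _ _ _ => Pge.
have Ple : P <= 1 by exact: prob_pos_tri_le1.
by rewrite ger0_norm ?subr_ge0 //; lra.
Unshelve. all: by end_near.
Qed.
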